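(* Let $\mathcal{O}$ be a decomposable set of Scott-open modalities. Then the open extensions of the behavioural equivalence $\equiv_{\mathcal{V}}$ and of the positive behavioural preorder $\sqsubseteq_{\mathcal{V}^+}$ are both compatible. (Consequently the open extension of $\equiv_{\mathcal{V}^+}$ is also compatible.)
   Context: Language: types $\tau ::= \mathbf{1} \mid \mathbf{N} \mid \tau \to \tau'$. A signature $\Sigma$ of effect operations is fixed, each $\sigma\in\Sigma$ having an arity of one of the forms $\alpha^n\to\alpha$, $\mathbf{N}\times\alpha^n\to\alpha$, $\alpha^{\mathbf{N}}\to\alpha$, $\mathbf{N}\times\alpha^{\mathbf{N}}\to\alpha$. Values $V,W ::= * \mid Z \mid S(V) \mid \lambda x{:}\tau.M \mid x$; computations $M,N ::= VW \mid \mathbf{return}\,V \mid \mathbf{let}\ M\Rightarrow x\ \mathbf{in}\ N \mid \mathbf{fix}(V) \mid \mathbf{case}\ V\ \mathbf{of}\ \{Z\Rightarrow M; S(x)\Rightarrow N\} \mid \sigma(M_0,\dots,M_{n-1}) \mid \sigma(V;M_0,\dots,M_{n-1}) \mid \sigma(V) \mid \sigma(V;W)$, simply typed in the standard call-by-value way ($\mathbf{fix}(V):\tau\to\tau'$ for $V:(\tau\to\tau')\to(\tau\to\tau')$; numeric first arguments of effect operations have type $\mathbf{N}$; in $\sigma(V)$, $\sigma(W;V)$ the argument $V$ has type $\mathbf{N}\to\tau$; the $M_i$ have the result type). $\mathit{Val}(\tau)$, $\mathit{Com}(\tau)$ are the closed values/computations of type $\tau$; $\overline{n}=S^n(Z)$.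 Effect trees: for a set $X$, $TX$ is the set of possibly infinite labelled trees whose leaves are labelled $\bot$ or by elements of $X$ and whose internal nodes are labelled by some $\sigma$ (with $n$ children for arity $\alpha^n\to\alpha$, $\mathbb{N}$-indexed children for $\alpha^{\mathbf{N}}\to\alpha$) or by $\sigma_m$, $m\in\mathbb{N}$ (for the arities $\mathbf{N}\times\alpha^n\to\alpha$, $\mathbf{N}\times\alpha^{\mathbf{N}}\to\alpha$). $t\le t'$ iff $t$ is obtained from $t'$ by replacing some subtrees by $\bot$-leaves; this is an $\omega$-cpo. Each $M\in\mathit{Com}(\tau)$ has an effect tree $|M|\in T(\mathit{Val}(\tau))$ given by call-by-value evaluation ($\beta$, case reduction, $\mathbf{fix}(F)$ reducing to $\mathbf{return}\ \lambda x.\mathbf{let}\ F(\lambda y.\mathbf{let}\ \mathbf{fix}\,F\Rightarrow z\ \mathbf{in}\ zy)\Rightarrow w\ \mathbf{in}\ wx$, let-sequencing): termination with $\mathbf{return}\,V$ gives the leaf $V$, reaching an effect operation gives a node labelled by it whose children are the trees of the continuations (for $\sigma(V)$: of $V\overline{0},V\overline{1},\dots$), divergence gives $\bot$; formally $|M|$ is the supremum of its finite-step approximations. Modalities: a set $\mathcal{O}$ with an interpretation $[\![o]\!]\subseteq T\mathbf{1}$ for each $o$ ($\mathbf{1}=\{*\}$). For $t\in TX$, $P\subseteq X$, $t[\in P]\in T\mathbf{1}$ replaces leaves in $P$ by $*$ and other $X$-leaves by $\bot$; $o(A)=\{t\in TX\mid t[\in A]\in[\![o]\!]\}$. $o$ is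 upwards closed if $[\![o]\!]$ is upward closed for $\le$; Scott-open if moreover, whenever $t_1\le t_2\le\dots$ has supremum in $[\![o]\!]$, some $t_n\in[\![o]\!]$. Logic $\mathcal{V}$: value formulas $VF(\tau)$ and computation formulas $CF(\tau)$: $\{n\}\in VF(\mathbf{N})$; $(V\mapsto\Phi)\in VF(\tau\to\tau')$ for $V\in\mathit{Val}(\tau)$, $\Phi\in CF(\tau')$; $o\,\phi\in CF(\tau)$ for $o\in\mathcal{O}$, $\phi\in VF(\tau)$; both closed under arbitrary $\bigwedge$, $\bigvee$, $\neg$. Semantics: $W\models\{n\}$ iff $W=\overline{n}$; $W\models(V\mapsto\Phi)$ iff $WV\models\Phi$; $M\models o\,\phi$ iff $|M|[\in\{V\mid V\models\phi\}]\in[\![o]\!]$; connectives classical. $\mathcal{V}^+$ is the negation-free fragment. For a fragment $\mathcal{L}$, $V\sqsubseteq_{\mathcal{L}}W$ iff every value formula of $\mathcal{L}$ satisfied by $V$ is satisfied by $W$ (same for computations, same type); $\equiv_{\mathcal{L}}$ is $\sqsubseteq_{\mathcal{L}}\cap\sqsupseteq_{\mathcal{L}}$. Decomposability: let $\mathcal{T}$ be the smallest class containing formulas $o(\top)$, $o(\bot)$ ($o\in\mathcal{O}$), closed under arbitrary $\bigvee,\bigwedge$, with $[\![o(\top)]\!]=o(\{*\})$, $[\![o(\bot)]\!]=o(\emptyset)$, unions/intersections for $\bigvee/\bigwedge$. For $t,t'\in T\mathbf{1}$: $t\trianglelefteq t'$ iff $\forall\Phi\in\mathcal{T}$, $t\in[\![\Phi]\!]\Rightarrow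 t'\in[\![\Phi]\!]$. For $r,r'\in TT\mathbf{1}$: $r\preccurlyeq r'$ iff $\forall o\in\mathcal{O}\,\forall\Phi\in\mathcal{T}$, $r\in o([\![\Phi]\!])\Rightarrow r'\in o([\![\Phi]\!])$. $\mu:TT\mathbf{1}\to T\mathbf{1}$ flattens a tree of trees. $\mathcal{O}$ is decomposable if $r\preccurlyeq r'$ implies $\mu r\trianglelefteq\mu r'$. Open extension and compatibility: for a relation $R$ on closed terms of equal type and aspect, $\Gamma\vdash M\,R^\circ\,N$ iff $M[\vec V/\vec x]\,R\,N[\vec V/\vec x]$ for all closed values $\vec V$ instantiating $\Gamma$. An open relation is compatible if it relates each variable to itself and is closed under every term constructor (Z, S, return, $\lambda$, application, fix, case, let, each effect operation): terms built by the same constructor from related immediate subterms (in the context extended by bound variables) are related. *)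

(* Defs.v *)
From Stdlib Require Import List Arith Relations ClassicalEpsilon.
Import ListNotations.


Inductive ty : Type := tUnit | tN | tArr (a b : ty).

(* Arities of effect operations:
   AFin n  : alpha^n -> alpha
   ANFin n : N x alpha^n -> alpha
   AInf    : alpha^N -> alpha
   ANInf   : N x alpha^N -> alpha *)
Inductive arity : Type := AFin (n : nat) | ANFin (n : nat) | AInf | ANInf.

Inductive val (Sig : Type) : Type :=
| VUnit : val Sig
| VZ : val Sig
| VS : val Sig -> val Sig
| VLam : ty -> com Sig -> val Sig                  (* lambda x:tau. M, x = var 0 *)
| VVar : nat -> val Sig
with com (Sig : Type) : Type :=
| CApp : val Sig -> val Sig -> com Sig
| CRet : val Sig -> com Sig
| CLet : com Sig -> com Sig -> com Sig             (* let M => x in N, x = var 0 in N *)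
| CFix : val Sig -> com Sig
| CCase : val Sig -> com Sig -> com Sig -> com Sig (* case V of {Z => M; S(x) => N} *)
| COp : Sig -> list (com Sig) -> com Sig
| COpN : Sig -> val Sig -> list (com Sig) -> com Sig
| COpI : Sig -> val Sig -> com Sig
| COpNI : Sig -> val Sig -> val Sig -> com Sig.

Arguments VUnit {Sig}. Arguments VZ {Sig}. Arguments VVar {Sig} _.
Arguments VS {Sig} _. Arguments VLam {Sig} _ _.
Arguments CApp {Sig} _ _. Arguments CRet {Sig} _. Arguments CLet {Sig} _ _.
Arguments CFix {Sig} _. Arguments CCase {Sig} _ _ _. Arguments COp {Sig} _ _.
Arguments COpN {Sig} _ _ _. Arguments COpI {Sig} _ _. Arguments COpNI {Sig} _ _ _.

Fixpoint numeral {Sig} (n : nat) : val Sig :=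
  match n with 0 => VZ | S n => VS (numeral n) end.

Inductive vtyped {Sig} (ar : Sig -> arity) : list ty -> val Sig -> ty -> Prop :=
| ty_unit G : vtyped ar G VUnit tUnit
| ty_Z G : vtyped ar G VZ tN
| ty_S G V : vtyped ar G V tN -> vtyped ar G (VS V) tN
| ty_lam G a b M : ctyped ar (a :: G) M b -> vtyped ar G (VLam a M) (tArr a b)
| ty_var G i a : nth_error G i = Some a -> vtyped ar G (VVar i) a
with ctyped {Sig} (ar : Sig -> arity) : list ty -> com Sig -> ty -> Prop :=
| ty_app G a b V W : vtyped ar G V (tArr a b) -> vtyped ar G W a ->
    ctyped ar G (CApp V W) b
| ty_ret G a V : vtyped ar G V a -> ctyped ar G (CRet V) a
| ty_let G a b M N : ctyped ar G M a -> ctyped ar (a :: G) N b ->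
    ctyped ar G (CLet M N) b
| ty_fix G a b V : vtyped ar G V (tArr (tArr a b) (tArr a b)) ->
    ctyped ar G (CFix V) (tArr a b)
| ty_case G a V M N : vtyped ar G V tN -> ctyped ar G M a -> ctyped ar (tN :: G) N a ->
    ctyped ar G (CCase V M N) a
| ty_op G a s n Ms : ar s = AFin n -> length Ms = n ->
    (forall M, In M Ms -> ctyped ar G M a) -> ctyped ar G (COp s Ms) a
| ty_opN G a s n V Ms : ar s = ANFin n -> vtyped ar G V tN -> length Ms = n ->
    (forall M, In M Ms -> ctyped ar G M a) -> ctyped ar G (COpN s V Ms) a
| ty_opI G a s V : ar s = AInf -> vtyped ar G V (tArr tN a) ->
    ctyped ar G (COpI s V) a
| ty_opNI G a s W V : ar s = ANInf -> vtyped ar G W tN -> vtyped ar G V (tArr tN a) ->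
    ctyped ar G (COpNI s W V) a.

Definition cval {Sig} (ar : Sig -> arity) (t : ty) : Type :=
  { V : val Sig | vtyped ar [] V t }.

Definition upr (r : nat -> nat) : nat -> nat :=
  fun n => match n with 0 => 0 | S n => S (r n) end.

Fixpoint ren_v {Sig} (r : nat -> nat) (v : val Sig) : val Sig :=
  match v with
  | VUnit => VUnit
  | VZ => VZ
  | VS v => VS (ren_v r v)
  | VLam t c => VLam t (ren_c (upr r) c)
  | VVar n => VVar (r n)
  end
with ren_c {Sig} (r : nat -> nat) (c : com Sig) : com Sig :=
  match c with
  | CApp v w => CApp (ren_v r v) (ren_v r w)
  | CRet v => CRet (ren_v r v)
  | CLet c1 c2 => CLet (ren_c r c1) (ren_c (upr r) c2)
  | CFix v => CFix (ren_v r v)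
  | CCase v c0 c1 => CCase (ren_v r v) (ren_c r c0) (ren_c (upr r) c1)
  | COp s cs => COp s (map (fun c => ren_c r c) cs)
  | COpN s v cs => COpN s (ren_v r v) (map (fun c => ren_c r c) cs)
  | COpI s v => COpI s (ren_v r v)
  | COpNI s w v => COpNI s (ren_v r w) (ren_v r v)
  end.

Definition ups {Sig} (sg : nat -> val Sig) : nat -> val Sig :=
  fun n => match n with 0 => VVar 0 | S n => ren_v S (sg n) end.

Fixpoint subst_v {Sig} (sg : nat -> val Sig) (v : val Sig) : val Sig :=
  match v with
  | VUnit => VUnit
  | VZ => VZ
  | VS v => VS (subst_v sg v)
  | VLam t c => VLam t (subst_c (ups sg) c)
  | VVar n => sg n
  end
with subst_c {Sig} (sg : nat -> val Sig) (c : com Sig) : com Sig :=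
  match c with
  | CApp v w => CApp (subst_v sg v) (subst_v sg w)
  | CRet v => CRet (subst_v sg v)
  | CLet c1 c2 => CLet (subst_c sg c1) (subst_c (ups sg) c2)
  | CFix v => CFix (subst_v sg v)
  | CCase v c0 c1 => CCase (subst_v sg v) (subst_c sg c0) (subst_c (ups sg) c1)
  | COp s cs => COp s (map (fun c => subst_c sg c) cs)
  | COpN s v cs => COpN s (subst_v sg v) (map (fun c => subst_c sg c) cs)
  | COpI s v => COpI s (subst_v sg v)
  | COpNI s w v => COpNI s (subst_v sg w) (subst_v sg v)
  end.

Definition scons {Sig} (V : val Sig) (sg : nat -> val Sig) : nat -> val Sig :=
  fun n => match n with 0 => V | S n => sg n end.

Definition subst1 {Sig} (M : com Sig) (V : val Sig) : com Sig :=
  subst_c (scons V (@VVar Sig)) M.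

(* A configuration is a stack of continuations (x.N, x = var 0) and a computation. *)
Definition config (Sig : Type) : Type := (list (com Sig) * com Sig)%type.

(* fix(F) reduces to
   return \x:a. let F (\y:a. let fix F => z in z y) => w in w x *)
Definition fix_unfold {Sig} (a : ty) (F : val Sig) : val Sig :=
  VLam a (CLet (CApp (ren_v S F)
                     (VLam a (CLet (CFix (ren_v (fun n => S (S n)) F))
                                   (CApp (VVar 0) (VVar 1)))))
               (CApp (VVar 0) (VVar 1))).

Inductive step {Sig} : config Sig -> config Sig -> Prop :=
| st_beta K t M V : step (K, CApp (VLam t M) V) (K, subst1 M V)
| st_caseZ K M N : step (K, CCase VZ M N) (K, M)
| st_caseS K V M N : step (K, CCase (VS V) M N) (K, subst1 N V)
| st_fix K a b body :
    step (K, CFix (VLam (tArr a b) body)) (K, CRet (fix_unfold a (VLam (tArr a b) body)))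
| st_let K M N : step (K, CLet M N) (N :: K, M)
| st_ret K N V : step (N :: K, CRet V) (K, subst1 N V).

Fixpoint num_of {Sig} (v : val Sig) : option nat :=
  match v with
  | VZ => Some 0
  | VS v => option_map S (num_of v)
  | _ => None
  end.

Inductive node (Sig X : Type) : Type :=
| NLeaf : X -> node Sig X
| NBot : node Sig X
| NOp : Sig -> node Sig X
| NOpM : Sig -> nat -> node Sig X.
Arguments NBot {Sig X}.
Arguments NLeaf {Sig X} _.
Arguments NOp {Sig X} _.
Arguments NOpM {Sig X} _ _.

Definition terminal {Sig} (c : config Sig) : Prop :=
  match c with
  | ([], CRet _) => True
  | (_, COp _ _) => True
  | (_, COpN _ V _) => num_of V <> None
  | (_, COpI _ _) => True
  | (_, COpNI _ W _) => num_of W <> None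
  | _ => False
  end.

Definition label_of {Sig} (c : config Sig) : node Sig (val Sig) :=
  match c with
  | ([], CRet V) => NLeaf V
  | (_, COp s _) => NOp s
  | (_, COpN s V _) => match num_of V with Some m => NOpM s m | None => NBot end
  | (_, COpI s _) => NOp s
  | (_, COpNI s W _) => match num_of W with Some m => NOpM s m | None => NBot end
  | _ => NBot
  end.

Definition child_of {Sig} (c : config Sig) (i : nat) : option (config Sig) :=
  match c with
  | (K, COp _ Ms) => match nth_error Ms i with Some M => Some (K, M) | None => None end
  | (K, COpN _ _ Ms) => match nth_error Ms i with Some M => Some (K, M) | None => None end
  | (K, COpI _ V) => Some (K, CApp V (numeral i))
  | (K, COpNI _ _ V) => Some (K, CApp V (numeral i))
  | _ => None
  end.

(* the terminal configuration reached from c, if any (evaluation is deterministic) *)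
Definition next {Sig} (c : config Sig) : option (config Sig) :=
  match excluded_middle_informative
          (exists T, clos_refl_trans _ (@step Sig) c T /\ terminal T) with
  | left H => Some (proj1_sig (constructive_indefinite_description _ H))
  | right _ => None
  end.

(* A (possibly infinite) tree is given by its labelling of positions (paths from
   the root, root first); [None] means the position is not in the tree. *)
Definition tree (Sig X : Type) : Type := list nat -> option (node Sig X).

Definition child_ok {Sig X} (ar : Sig -> arity) (l : node Sig X) (i : nat) : Prop :=
  match l with
  | NOp s => match ar s with AFin n => i < n | AInf => True | _ => False end
  | NOpM s _ => match ar s with ANFin n => i < n | ANInf => True | _ => False end
  | _ => False
  end.

Definition label_ok {Sig X} (ar : Sig -> arity) (L : X -> Prop) (l : node Sig X) : Prop :=
  match l with
  | NLeaf x => L x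
  | NBot => True
  | NOp s => match ar s with AFin _ | AInf => True | _ => False end
  | NOpM s _ => match ar s with ANFin _ | ANInf => True | _ => False end
  end.

Definition wf_tree {Sig X} (ar : Sig -> arity) (L : X -> Prop) (t : tree Sig X) : Prop :=
  t [] <> None /\
  (forall p l, t p = Some l -> label_ok ar L l) /\
  (forall p i, t (p ++ [i]) <> None <-> exists l, t p = Some l /\ child_ok ar l i).

Definition T1 {Sig} (ar : Sig -> arity) (t : tree Sig unit) : Prop :=
  wf_tree ar (fun _ => True) t.
Definition TT1 {Sig} (ar : Sig -> arity) (r : tree Sig (tree Sig unit)) : Prop :=
  wf_tree ar (T1 ar) r.

Fixpoint tree_of_config {Sig} (p : list nat) (c : config Sig) : option (node Sig (val Sig)) :=
  match next c with
  | None => match p with [] => Some NBot | _ => None end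
  | Some T =>
      match p with
      | [] => Some (label_of T)
      | i :: p' => match child_of T i with
                   | Some c' => tree_of_config p' c'
                   | None => None
                   end
      end
  end.

Definition eff_tree {Sig} (M : com Sig) : tree Sig (val Sig) :=
  fun p => tree_of_config p ([], M).

(* t <= t' : t is obtained from t' by replacing some subtrees by bottom leaves *)
Definition tle {Sig X} (t t' : tree Sig X) : Prop :=
  forall p l, t p = Some l -> (l = NBot /\ t' p <> None) \/ t' p = Some l.

Definition restrict {Sig X} (t : tree Sig X) (P : X -> Prop) : tree Sig unit :=
  fun p => match t p with
           | Some (NLeaf x) =>
               Some (if excluded_middle_informative (P x) then NLeaf tt else NBot)
           | Some NBot => Some NBot
           | Some (NOp s) => Some (NOp s)
           | Some (NOpM s m) => Some (NOpM s m)
           | None => None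
           end.

Definition omod {Sig O X} (interp : O -> tree Sig unit -> Prop) (o : O)
  (A : X -> Prop) (t : tree Sig X) : Prop :=
  interp o (restrict t A).

Definition upward_closed {Sig} (ar : Sig -> arity) (A : tree Sig unit -> Prop) : Prop :=
  forall t t', T1 ar t -> T1 ar t' -> tle t t' -> A t -> A t'.

Definition is_sup {Sig} (ar : Sig -> arity) (c : nat -> tree Sig unit) (t : tree Sig unit) : Prop :=
  (forall n, tle (c n) t) /\
  (forall u, T1 ar u -> (forall n, tle (c n) u) -> tle t u).

Definition scott_open {Sig} (ar : Sig -> arity) (A : tree Sig unit -> Prop) : Prop :=
  upward_closed ar A /\
  forall (c : nat -> tree Sig unit) (t : tree Sig unit),
    (forall n, T1 ar (c n)) -> (forall n, tle (c n) (c (S n))) ->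
    T1 ar t -> is_sup ar c t -> A t -> exists n, A (c n).

Inductive TF (O : Type) : Type :=
| TTop : O -> TF O
| TBotF : O -> TF O
| TOr : forall I : Type, (I -> TF O) -> TF O
| TAnd : forall I : Type, (I -> TF O) -> TF O.
Arguments TTop {O} _. Arguments TBotF {O} _.
Arguments TOr {O} {I} _. Arguments TAnd {O} {I} _.

Fixpoint semT {Sig O} (interp : O -> tree Sig unit -> Prop) (F : TF O) (t : tree Sig unit) : Prop :=
  match F with
  | TTop o => omod interp o (fun _ : unit => True) t
  | TBotF o => omod interp o (fun _ : unit => False) t
  | TOr f => exists i, semT interp (f i) t
  | TAnd f => forall i, semT interp (f i) t
  end.

Definition tri {Sig O} (interp : O -> tree Sig unit -> Prop) (t t' : tree Sig unit) : Prop :=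
  forall F : TF O, semT interp F t -> semT interp F t'.

Definition prec {Sig O} (interp : O -> tree Sig unit -> Prop)
  (r r' : tree Sig (tree Sig unit)) : Prop :=
  forall (o : O) (F : TF O), omod interp o (semT interp F) r -> omod interp o (semT interp F) r'.

(* flattening mu : TT1 -> T1 ; q = position already traversed in the outer tree *)
Fixpoint muf {Sig} (r : tree Sig (tree Sig unit)) (q p : list nat) {struct p}
  : option (node Sig unit) :=
  match r q with
  | Some (NLeaf t) => t p
  | Some NBot => match p with [] => Some NBot | _ => None end
  | Some (NOp s) => match p with [] => Some (NOp s) | i :: p' => muf r (q ++ [i]) p' end
  | Some (NOpM s m) => match p with [] => Some (NOpM s m) | i :: p' => muf r (q ++ [i]) p' end
  | None => None
  end.

Definition mu {Sig} (r : tree Sig (tree Sig unit)) : tree Sig unit := fun p => muf r [] p.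

Definition decomposable {Sig O} (ar : Sig -> arity) (interp : O -> tree Sig unit -> Prop) : Prop :=
  forall r r', TT1 ar r -> TT1 ar r' -> prec interp r r' -> tri interp (mu r) (mu r').

Inductive VF {Sig} (ar : Sig -> arity) (O : Type) : ty -> Type :=
| VNum : nat -> VF ar O tN
| VMaps : forall a b, cval ar a -> CF ar O b -> VF ar O (tArr a b)
| VAnd : forall t (I : Type), (I -> VF ar O t) -> VF ar O t
| VOr : forall t (I : Type), (I -> VF ar O t) -> VF ar O t
| VNot : forall t, VF ar O t -> VF ar O t
with CF {Sig} (ar : Sig -> arity) (O : Type) : ty -> Type :=
| CMod : forall t, O -> VF ar O t -> CF ar O t
| CAnd : forall t (I : Type), (I -> CF ar O t) -> CF ar O t
| COr : forall t (I : Type), (I -> CF ar O t) -> CF ar O t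
| CNot : forall t, CF ar O t -> CF ar O t.
Arguments VNum {Sig ar O} _. Arguments VMaps {Sig ar O a b} _ _.
Arguments VAnd {Sig ar O t I} _. Arguments VOr {Sig ar O t I} _.
Arguments VNot {Sig ar O t} _.
Arguments CMod {Sig ar O t} _ _. Arguments CAnd {Sig ar O t I} _.
Arguments COr {Sig ar O t I} _. Arguments CNot {Sig ar O t} _.

Fixpoint sat_v {Sig ar O} (interp : O -> tree Sig unit -> Prop) {t}
  (phi : @VF Sig ar O t) (W : val Sig) : Prop :=
  match phi with
  | VNum n => W = numeral n
  | VMaps V Phi => sat_c interp Phi (CApp W (proj1_sig V))
  | VAnd f => forall i, sat_v interp (f i) W
  | VOr f => exists i, sat_v interp (f i) W
  | VNot phi => ~ sat_v interp phi W
  end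
with sat_c {Sig ar O} (interp : O -> tree Sig unit -> Prop) {t}
  (Phi : @CF Sig ar O t) (M : com Sig) : Prop :=
  match Phi with
  | CMod o phi => interp o (restrict (eff_tree M) (fun V => sat_v interp phi V))
  | CAnd f => forall i, sat_c interp (f i) M
  | COr f => exists i, sat_c interp (f i) M
  | CNot Phi => ~ sat_c interp Phi M
  end.

Fixpoint pos_v {Sig ar O t} (phi : @VF Sig ar O t) : Prop :=
  match phi with
  | VNum _ => True
  | VMaps _ Phi => pos_c Phi
  | VAnd f => forall i, pos_v (f i)
  | VOr f => forall i, pos_v (f i)
  | VNot _ => False
  end
with pos_c {Sig ar O t} (Phi : @CF Sig ar O t) : Prop :=
  match Phi with
  | CMod _ phi => pos_v phi
  | CAnd f => forall i, pos_c (f i)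
  | COr f => forall i, pos_c (f i)
  | CNot _ => False
  end.

(* A fragment L is given by predicates on value and computation formulas. *)
Definition le_L_v {Sig} (ar : Sig -> arity) {O} (interp : O -> tree Sig unit -> Prop)
  (Lv : forall t, @VF Sig ar O t -> Prop) (t : ty) (V W : val Sig) : Prop :=
  vtyped ar [] V t /\ vtyped ar [] W t /\
  forall phi : VF ar O t, Lv t phi -> sat_v interp phi V -> sat_v interp phi W.

Definition le_L_c {Sig} (ar : Sig -> arity) {O} (interp : O -> tree Sig unit -> Prop)
  (Lc : forall t, @CF Sig ar O t -> Prop) (t : ty) (M N : com Sig) : Prop :=
  ctyped ar [] M t /\ ctyped ar [] N t /\
  forall Phi : CF ar O t, Lc t Phi -> sat_c interp Phi M -> sat_c interp Phi N.

Definition eq_L_v {Sig} (ar : Sig -> arity) {O} (interp : O -> tree Sig unit -> Prop)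
  (Lv : forall t, @VF Sig ar O t -> Prop) (t : ty) (V W : val Sig) : Prop :=
  le_L_v ar interp Lv t V W /\ le_L_v ar interp Lv t W V.

Definition eq_L_c {Sig} (ar : Sig -> arity) {O} (interp : O -> tree Sig unit -> Prop)
  (Lc : forall t, @CF Sig ar O t -> Prop) (t : ty) (M N : com Sig) : Prop :=
  le_L_c ar interp Lc t M N /\ le_L_c ar interp Lc t N M.

Definition allV {Sig ar O} : forall t, @VF Sig ar O t -> Prop := fun _ _ => True.
Definition allC {Sig ar O} : forall t, @CF Sig ar O t -> Prop := fun _ _ => True.
Definition posV {Sig ar O} : forall t, @VF Sig ar O t -> Prop := fun t phi => pos_v phi.
Definition posC {Sig ar O} : forall t, @CF Sig ar O t -> Prop := fun t Phi => pos_c Phi.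

Definition closing {Sig} (ar : Sig -> arity) (G : list ty) (sg : nat -> val Sig) : Prop :=
  forall i a, nth_error G i = Some a -> vtyped ar [] (sg i) a.

Definition open_v {Sig} (ar : Sig -> arity) (R : ty -> val Sig -> val Sig -> Prop)
  (G : list ty) (t : ty) (V W : val Sig) : Prop :=
  vtyped ar G V t /\ vtyped ar G W t /\
  forall sg, closing ar G sg -> R t (subst_v sg V) (subst_v sg W).

Definition open_c {Sig} (ar : Sig -> arity) (R : ty -> com Sig -> com Sig -> Prop)
  (G : list ty) (t : ty) (M N : com Sig) : Prop :=
  ctyped ar G M t /\ ctyped ar G N t /\
  forall sg, closing ar G sg -> R t (subst_c sg M) (subst_c sg N).

Definition compatible {Sig} (ar : Sig -> arity)
  (RV : list ty -> ty -> val Sig -> val Sig -> Prop)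
  (RC : list ty -> ty -> com Sig -> com Sig -> Prop) : Prop :=
  (forall G i a, nth_error G i = Some a -> RV G a (VVar i) (VVar i)) /\
  (forall G, RV G tUnit VUnit VUnit) /\
  (forall G, RV G tN VZ VZ) /\
  (forall G V W, RV G tN V W -> RV G tN (VS V) (VS W)) /\
  (forall G a b M N, RC (a :: G) b M N -> RV G (tArr a b) (VLam a M) (VLam a N)) /\
  (forall G a V W, RV G a V W -> RC G a (CRet V) (CRet W)) /\
  (forall G a b V V' W W', RV G (tArr a b) V V' -> RV G a W W' ->
      RC G b (CApp V W) (CApp V' W')) /\
  (forall G a b V W, RV G (tArr (tArr a b) (tArr a b)) V W ->
      RC G (tArr a b) (CFix V) (CFix W)) /\
  (forall G a V V' M M' N N', RV G tN V V' -> RC G a M M' -> RC (tN :: G) a N N' ->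
      RC G a (CCase V M N) (CCase V' M' N')) /\
  (forall G a b M M' N N', RC G a M M' -> RC (a :: G) b N N' ->
      RC G b (CLet M N) (CLet M' N')) /\
  (forall G a s n Ms Ns, ar s = AFin n -> length Ms = n ->
      Forall2 (RC G a) Ms Ns -> RC G a (COp s Ms) (COp s Ns)) /\
  (forall G a s n V V' Ms Ns, ar s = ANFin n -> RV G tN V V' -> length Ms = n ->
      Forall2 (RC G a) Ms Ns -> RC G a (COpN s V Ms) (COpN s V' Ns)) /\
  (forall G a s V V', ar s = AInf -> RV G (tArr tN a) V V' ->
      RC G a (COpI s V) (COpI s V')) /\
  (forall G a s W W' V V', ar s = ANInf -> RV G tN W W' -> RV G (tArr tN a) V V' ->
      RC G a (COpNI s W V) (COpNI s W' V')).

(* Main.v *)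
Require Import Defs.
From Stdlib Require Import List Arith Lia Relations Classical ClassicalEpsilon
  FunctionalExtensionality PropExtensionality.
Import ListNotations.

(** Howe's method on closed terms only. The behavioural preorder [R] is closed under
[t = U[s]], [s H s'], [U[s'] R t'] |- [t H t'], where [s] and [s'] substitute closed values;
binders need no rule of their own because abstractions are compared by applying them.
By induction on the fuel [n], if [M H N] then the [n]-th approximant of the effect tree of
[M] is simulated by the effect tree of [N] up to [H] on leaves: sequencing and effect
operations are flattenings of trees of trees, where decomposability applies, and
Scott-openness passes to the limit. Hence [H] is a simulation, and a simulation (symmetric,
if the logic has negation) preserves all formulas, by induction on formulas. So [R] contains
[H], that is, [R] is closed under substitution of related values. *)

(** * Renaming and substitution *)

(** The obstacle is that [Rv] at arrow type compares two functions on one common argument, whereas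
    compatibility of application and [let] also varies the argument, that is, substitutes related
    values into one body. Induction on formulas does not yield this, hence Howe's relation. Fuel is
    spent on the left only, the right side staying a whole effect tree, so that the trailing step
    along [R] is absorbed by composing liftings. Decomposability speaks of trees with trivial
    leaves, simulations of trees with values at the leaves. The bridge is [lift]: two trees are
    related by [lift interp S] exactly when, for every [P], the restriction of the first to [P] is
    below the restriction of the second to the [S]-image of [P] in the sense of [tri]; the atoms
    $o(\bot)$ come from the empty [P]. Both logics are treated at once through a proposition [neg]:
    when it holds, the preorder is symmetric and so coincides with the equivalence. *)

Section ValComInd.
Variables (Sig : Type) (P : val Sig -> Prop) (Q : com Sig -> Prop).
Hypothesis HUnit : P VUnit.
Hypothesis HZ : P VZ.
Hypothesis HS : forall v, P v -> P (VS v).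
Hypothesis HLam : forall t c, Q c -> P (VLam t c).
Hypothesis HVar : forall n, P (VVar n).
Hypothesis HApp : forall v w, P v -> P w -> Q (CApp v w).
Hypothesis HRet : forall v, P v -> Q (CRet v).
Hypothesis HLet : forall c d, Q c -> Q d -> Q (CLet c d).
Hypothesis HFix : forall v, P v -> Q (CFix v).
Hypothesis HCase : forall v c d, P v -> Q c -> Q d -> Q (CCase v c d).
Hypothesis HOp : forall s cs, Forall Q cs -> Q (COp s cs).
Hypothesis HOpN : forall s v cs, P v -> Forall Q cs -> Q (COpN s v cs).
Hypothesis HOpI : forall s v, P v -> Q (COpI s v).
Hypothesis HOpNI : forall s w v, P w -> P v -> Q (COpNI s w v).

(** The generated schemes give no hypothesis for the computations inside the argument list of an
    operation; the inner fixpoint [all] supplies it as a [Forall]. *)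
Fixpoint val_nested_ind (v : val Sig) : P v :=
  match v with
  | VUnit => HUnit
  | VZ => HZ
  | VS v => HS v (val_nested_ind v)
  | VLam t c => HLam t c (com_nested_ind c)
  | VVar n => HVar n
  end
with com_nested_ind (c : com Sig) : Q c :=
  let all := fix all (cs : list (com Sig)) : Forall Q cs :=
    match cs with
    | [] => Forall_nil Q
    | c :: cs => Forall_cons c (com_nested_ind c) (all cs)
    end in
  match c with
  | CApp v w => HApp v w (val_nested_ind v) (val_nested_ind w)
  | CRet v => HRet v (val_nested_ind v)
  | CLet c d => HLet c d (com_nested_ind c) (com_nested_ind d)
  | CFix v => HFix v (val_nested_ind v)
  | CCase v c d => HCase v c d (val_nested_ind v) (com_nested_ind c) (com_nested_ind d)
  | COp s cs => HOp s cs (all cs)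
  | COpN s v cs => HOpN s v cs (val_nested_ind v) (all cs)
  | COpI s v => HOpI s v (val_nested_ind v)
  | COpNI s w v => HOpNI s w v (val_nested_ind w) (val_nested_ind v)
  end.

Lemma val_com_ind : (forall v, P v) /\ (forall c, Q c).
Proof. split; [exact val_nested_ind | exact com_nested_ind]. Qed.
End ValComInd.

Section Substitution.
Context {Sig : Type}.
Implicit Types (r : nat -> nat) (s : nat -> val Sig) (v V : val Sig) (c M : com Sig).

Ltac syntactic :=
  apply val_com_ind; intros; simpl; f_equal;
  rewrite ?map_map; try apply map_ext_Forall; try (eapply Forall_impl; [|eassumption]);
  simpl; intros; auto.

Lemma upr_comp r1 r2 : (fun n => upr r2 (upr r1 n)) = upr (fun n => r2 (r1 n)).
Proof. extensionality n. now destruct n. Qed.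

Lemma ren_ren :
  (forall v r1 r2, ren_v r2 (ren_v r1 v) = ren_v (fun n => r2 (r1 n)) v) /\
  (forall c r1 r2, ren_c r2 (ren_c r1 c) = ren_c (fun n => r2 (r1 n)) c).
Proof. syntactic; rewrite <- (upr_comp r1 r2); auto. Qed.

Lemma ups_upr r s : (fun n => ups s (upr r n)) = ups (fun n => s (r n)).
Proof. extensionality n. now destruct n. Qed.

Lemma subst_ren :
  (forall v r s, subst_v s (ren_v r v) = subst_v (fun n => s (r n)) v) /\
  (forall c r s, subst_c s (ren_c r c) = subst_c (fun n => s (r n)) c).
Proof. syntactic; rewrite <- (ups_upr r s); auto. Qed.

Lemma upr_ups r s : (fun n => ren_v (upr r) (ups s n)) = ups (fun n => ren_v r (s n)).
Proof.
  extensionality n. destruct n; simpl; auto. now rewrite !(proj1 ren_ren).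
Qed.

Lemma ren_subst :
  (forall v r s, ren_v r (subst_v s v) = subst_v (fun n => ren_v r (s n)) v) /\
  (forall c r s, ren_c r (subst_c s c) = subst_c (fun n => ren_v r (s n)) c).
Proof. syntactic; rewrite <- (upr_ups r s); auto. Qed.

Lemma ups_ups s1 s2 :
  (fun n => subst_v (ups s2) (ups s1 n)) = ups (fun n => subst_v s2 (s1 n)).
Proof.
  extensionality n. destruct n; simpl; auto.
  now rewrite (proj1 subst_ren), (proj1 ren_subst).
Qed.

Lemma subst_subst :
  (forall v s1 s2, subst_v s2 (subst_v s1 v) = subst_v (fun n => subst_v s2 (s1 n)) v) /\
  (forall c s1 s2, subst_c s2 (subst_c s1 c) = subst_c (fun n => subst_v s2 (s1 n)) c).
Proof. syntactic; rewrite <- (ups_ups s1 s2); auto. Qed.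

Lemma ups_var : ups (@VVar Sig) = VVar.
Proof. extensionality n. now destruct n. Qed.

Lemma subst_var :
  (forall v, subst_v VVar v = v) /\ (forall c, subst_c VVar c = c).
Proof.
  syntactic; rewrite ?ups_var; auto;
  match goal with H : Forall _ ?l |- _ => induction H; simpl; f_equal; auto end.
Qed.

Lemma subst1_ups s c V : subst1 (subst_c (ups s) c) V = subst_c (scons V s) c.
Proof.
  unfold subst1. rewrite (proj2 subst_subst). f_equal. extensionality n.
  destruct n; simpl; auto. rewrite (proj1 subst_ren). apply subst_var.
Qed.

Lemma subst_fix_unfold s a V : subst_v s (fix_unfold a V) = fix_unfold a (subst_v s V).
Proof.
  unfold fix_unfold. simpl.
  rewrite !(proj1 subst_ren), !(proj1 ren_subst). simpl.
  repeat f_equal. extensionality n. apply ren_ren.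
Qed.
End Substitution.

(** * Typing *)

Section Typing.
Context {Sig : Type} (ar : Sig -> arity).
Implicit Types (G D : list ty) (V : val Sig) (M : com Sig).

Scheme vtyped_mut := Minimality for vtyped Sort Prop
with ctyped_mut := Minimality for ctyped Sort Prop.
Combined Scheme typed_mut from vtyped_mut, ctyped_mut.

Ltac typing := econstructor; eauto; rewrite ?length_map; auto;
  intros ? [? [<- ?]]%in_map_iff; eauto.

Lemma typed_ren :
  (forall G V t, vtyped ar G V t -> forall D r,
     (forall i a, nth_error G i = Some a -> nth_error D (r i) = Some a) ->
     vtyped ar D (ren_v r V) t) /\
  (forall G M t, ctyped ar G M t -> forall D r,
     (forall i a, nth_error G i = Some a -> nth_error D (r i) = Some a) ->
     ctyped ar D (ren_c r M) t).
Proof.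
  assert (U : forall G D b r,
    (forall i a, nth_error G i = Some a -> nth_error D (r i) = Some a) ->
    forall i a, nth_error (b :: G) i = Some a -> nth_error (b :: D) (upr r i) = Some a).
  { intros G D b r H [|i] a; simpl; auto. }
  apply typed_mut; intros; simpl; typing.
Qed.

(** For [D = []] this is [closing] up to conversion, and closing substitutions are passed to it
    silently. *)
Definition styped G D (s : nat -> val Sig) : Prop :=
  forall i a, nth_error G i = Some a -> vtyped ar D (s i) a.

Lemma styped_ups G D a s : styped G D s -> styped (a :: G) (a :: D) (ups s).
Proof.
  intros H [|i] b; simpl; intros E; [constructor; auto|].
  eapply typed_ren; eauto.
Qed.

Lemma styped_scons G D a s V :
  vtyped ar D V a -> styped G D s -> styped (a :: G) D (scons V s).
Proof. intros HV H [|i] b; simpl; intros E; [congruence|auto]. Qed.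

Lemma typed_subst :
  (forall G V t, vtyped ar G V t -> forall D s, styped G D s -> vtyped ar D (subst_v s V) t) /\
  (forall G M t, ctyped ar G M t -> forall D s, styped G D s -> ctyped ar D (subst_c s M) t).
Proof.
  pose proof styped_ups. apply typed_mut; intros; simpl; try solve [typing].
  auto.
Qed.

Lemma typed_subst1 a b M V :
  ctyped ar [a] M b -> vtyped ar [] V a -> ctyped ar [] (subst1 M V) b.
Proof.
  intros HM HV. eapply typed_subst; eauto. apply styped_scons; auto.
  intros [|i] c; discriminate.
Qed.

Lemma numeral_typed G n : vtyped ar G (numeral n) tN.
Proof. induction n; constructor; auto. Qed.

Lemma closed_nat V : vtyped ar [] V tN -> exists n, V = numeral n.
Proof.
  remember [] as G. remember tN as t. induction 1; try discriminate; subst.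
  - now exists 0.
  - destruct IHvtyped as [n ->]; auto. now exists (S n).
  - now destruct i.
Qed.

Lemma num_of_numeral n : @num_of Sig (numeral n) = Some n.
Proof. induction n; simpl; auto. now rewrite IHn. Qed.

Lemma closed_arrow V a b : vtyped ar [] V (tArr a b) ->
  exists M, V = VLam a M /\ ctyped ar [a] M b.
Proof. inversion 1; subst; eauto. now destruct i. Qed.

Lemma fix_unfold_typed G V a b :
  vtyped ar G V (tArr (tArr a b) (tArr a b)) -> vtyped ar G (fix_unfold a V) (tArr a b).
Proof.
  intros H. unfold fix_unfold.
  repeat econstructor; simpl; try reflexivity;
  try (eapply typed_ren; [exact H|]; intros; simpl; auto).
Qed.
End Typing.

(** * Trees *)

Section Trees.
Context {Sig : Type} (ar : Sig -> arity).

(** Gives trees, encoded by positions, their coalgebraic view as a root label with a partial family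
    of subtrees. Together with [wf_inv] and [wf_coind] it replaces most reasoning about paths by
    equations between trees. *)
Definition node_tree {X} (l : node Sig X) (ch : nat -> option (tree Sig X)) : tree Sig X :=
  fun p => match p with
           | [] => Some l
           | i :: p => match ch i with Some t => t p | None => None end
           end.

Definition leaf_tree {X} (l : node Sig X) : tree Sig X := node_tree l (fun _ => None).

Definition map_node {X Y} (f : X -> Y) (l : node Sig X) : node Sig Y :=
  match l with
  | NLeaf x => NLeaf (f x)
  | NBot => NBot
  | NOp s => NOp s
  | NOpM s m => NOpM s m
  end.

Definition map_tree {X Y} (f : X -> Y) (t : tree Sig X) : tree Sig Y :=
  fun p => option_map (map_node f) (t p).

Definition restrict_node {X} (P : X -> Prop) (l : node Sig X) : node Sig unit :=
  match l with
  | NLeaf x => if excluded_middle_informative (P x) then NLeaf tt else NBot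
  | NBot => NBot
  | NOp s => NOp s
  | NOpM s m => NOpM s m
  end.

Lemma restrictE {X} (P : X -> Prop) (t : tree Sig X) p :
  restrict t P p = option_map (restrict_node P) (t p).
Proof. unfold restrict. now destruct (t p) as [[]|]. Qed.

Lemma restrict_node_tree {X} (P : X -> Prop) l ch :
  restrict (node_tree l ch) P =
  node_tree (restrict_node P l) (fun i => option_map (fun t => restrict t P) (ch i)).
Proof.
  extensionality p. rewrite restrictE. destruct p as [|i p]; simpl; auto.
  destruct (ch i); simpl; auto. now rewrite restrictE.
Qed.

Lemma map_node_tree {X Y} (f : X -> Y) l ch :
  map_tree f (node_tree l ch) =
  node_tree (map_node f l) (fun i => option_map (map_tree f) (ch i)).
Proof.
  extensionality p. unfold map_tree. destruct p as [|i p]; simpl; auto.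
  now destruct (ch i).
Qed.

Lemma restrict_map {X Y} (f : X -> Y) (P : Y -> Prop) (t : tree Sig X) :
  restrict (map_tree f t) P = restrict t (fun x => P (f x)).
Proof.
  extensionality p. rewrite !restrictE. unfold map_tree. now destruct (t p) as [[]|].
Qed.

Lemma restrict_restrict {X} (P : X -> Prop) (Q : unit -> Prop) (t : tree Sig X) :
  restrict (restrict t P) Q = restrict t (fun x => P x /\ Q tt).
Proof.
  extensionality p. rewrite !restrictE. destruct (t p) as [[x| | |]|]; simpl; auto.
  do 2 f_equal. repeat destruct excluded_middle_informative; simpl; auto; try tauto;
  destruct excluded_middle_informative; tauto.
Qed.

Lemma restrict_full (t : tree Sig unit) : restrict t (fun _ => True) = t.
Proof.
  extensionality p. rewrite restrictE. destruct (t p) as [[[]| | |]|]; simpl; auto.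
  destruct excluded_middle_informative; tauto.
Qed.

Lemma wf_inv {X} (L : X -> Prop) t : wf_tree ar L t ->
  exists l ch, t = node_tree l ch /\ label_ok ar L l /\
    (forall i, child_ok ar l i <-> ch i <> None) /\
    (forall i u, ch i = Some u -> wf_tree ar L u).
Proof.
  intros (H0 & HL & HC). destruct (t []) as [l|] eqn:E; [clear H0|congruence].
  exists l, (fun i => match t [i] with Some _ => Some (fun p => t (i :: p)) | None => None end).
  (* Domains are closed under prefixes; the induction removes the last index of the path because
     [wf_tree] speaks of [p ++ [i]]. *)
  assert (none : forall i, t [i] = None -> forall p, t (i :: p) = None).
  { intros i Hi p. induction p as [|j p IH] using rev_ind; auto.
    apply NNPP. intros N. apply (HC (i :: p) j) in N as (? & ? & ?). congruence. }
  repeat split.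
  - extensionality p. destruct p as [|i p]; simpl; auto.
    destruct (t [i]) eqn:Ei; auto.
  - eauto.
  - intros C. assert (N : t [i] <> None) by (apply (HC []); eauto). now destruct (t [i]).
  - intros N. destruct (HC [] i) as [[l' [E' C]] _]; simpl.
    + intros Ei. now rewrite Ei in N.
    + congruence.
  - destruct (t [i]) eqn:Ei; inversion H; subst. congruence.
  - destruct (t [i]) eqn:Ei; inversion H; subst. eauto.
  - destruct (t [i]) eqn:Ei; inversion H; subst. apply (HC (i :: p)).
  - destruct (t [i]) eqn:Ei; inversion H; subst. apply (HC (i :: p)).
Qed.

(** Well-formedness is the greatest property closed under destructing a tree into label and
    children; each of its clauses follows by induction on the position, descending from the root
    while [Q] is kept. *)
Lemma wf_coind {X} (L : X -> Prop) (Q : tree Sig X -> Prop) :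
  (forall t, Q t -> exists l ch, t = node_tree l ch /\ label_ok ar L l /\
     (forall i, child_ok ar l i <-> ch i <> None) /\
     (forall i u, ch i = Some u -> Q u)) ->
  forall t, Q t -> wf_tree ar L t.
Proof.
  intros H t Qt. repeat split.
  - destruct (H t Qt) as (l & ch & -> & _). discriminate.
  - intros p. revert t Qt. induction p as [|i p IH]; intros t Qt l E;
      destruct (H t Qt) as (l' & ch & -> & Hl & Hc & Hq); simpl in E.
    + congruence.
    + destruct (ch i) eqn:Ei; [eauto|discriminate].
  - revert t Qt. induction p as [|j p IH]; intros t Qt;
      destruct (H t Qt) as (l' & ch & -> & Hl & Hc & Hq); simpl.
    + intros N. exists l'. split; auto. apply Hc. now destruct (ch i).
    + destruct (ch j) eqn:Ej; [eauto|tauto].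
  - revert t Qt. induction p as [|j p IH]; intros t Qt;
      destruct (H t Qt) as (l' & ch & -> & Hl & Hc & Hq); simpl.
    + intros (l & E & C). inversion E; subst. apply Hc in C.
      destruct (ch i) as [u|] eqn:Ei; [|congruence].
      destruct (H u) as (? & ? & -> & _); eauto. discriminate.
    + destruct (ch j) eqn:Ej; [eauto|intros (? & ? & _); discriminate].
Qed.

Lemma wf_node_tree {X} (L : X -> Prop) l ch :
  label_ok ar L l -> (forall i, child_ok ar l i <-> ch i <> None) ->
  (forall i u, ch i = Some u -> wf_tree ar L u) -> wf_tree ar L (node_tree l ch).
Proof.
  intros Hl Hc Hw. apply wf_coind with (Q := fun t => t = node_tree l ch \/ wf_tree ar L t); auto.
  intros t [->|Ht].
  - exists l, ch. eauto 6.
  - destruct (wf_inv _ _ Ht) as (l' & ch' & -> & ? & ? & ?). exists l', ch'. eauto 6.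
Qed.

Lemma wf_leaf_tree {X} (L : X -> Prop) l :
  label_ok ar L l -> (forall i, ~ child_ok ar l i) -> wf_tree ar L (leaf_tree l).
Proof. intros. apply wf_node_tree; auto; [firstorder congruence|discriminate]. Qed.

Lemma wf_bot {X} (L : X -> Prop) : wf_tree ar L (leaf_tree NBot).
Proof. apply wf_leaf_tree; simpl; auto. Qed.

Lemma wf_restrict {X} (L P : X -> Prop) t : wf_tree ar L t -> T1 ar (restrict t P).
Proof.
  intros H. apply wf_coind with (Q := fun u => exists t, wf_tree ar L t /\ u = restrict t P).
  2: eauto.
  clear. intros ? [t [H ->]]. destruct (wf_inv _ _ H) as (l & ch & -> & Hl & Hc & Hw).
  rewrite restrict_node_tree. eexists _, _. split; [reflexivity|]. repeat split.
  - destruct l; simpl; auto. now destruct excluded_middle_informative.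
  - intros C. assert (N : ch i <> None).
    { apply Hc. destruct l; simpl in *; auto. now destruct excluded_middle_informative. }
    now destruct (ch i).
  - intros N. assert (C : child_ok ar l i). { apply Hc. now destruct (ch i). }
    destruct l; simpl in *; auto. tauto.
  - intros i u E. destruct (ch i) eqn:Ei; inversion E. eauto.
Qed.

Lemma wf_map {X Y} (L : X -> Prop) (L' : Y -> Prop) f t :
  (forall x, L x -> L' (f x)) -> wf_tree ar L t -> wf_tree ar L' (map_tree f t).
Proof.
  intros Hf H. apply wf_coind with (Q := fun u => exists t, wf_tree ar L t /\ u = map_tree f t).
  2: eauto.
  clear t H. intros ? [t [H ->]]. destruct (wf_inv _ _ H) as (l & ch & -> & Hl & Hc & Hw).
  rewrite map_node_tree. eexists _, _. split; [reflexivity|]. repeat split.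
  - destruct l; simpl; auto.
  - intros C. assert (N : ch i <> None) by (apply Hc; now destruct l).
    now destruct (ch i).
  - intros N. assert (C : child_ok ar l i). { apply Hc. now destruct (ch i). }
    now destruct l.
  - intros i u E. destruct (ch i) eqn:Ei; inversion E. eauto.
Qed.

(** * The approximation order on trees *)

Lemma tle_refl {X} (t : tree Sig X) : tle t t.
Proof. right; auto. Qed.

Lemma tle_trans {X} (t u v : tree Sig X) : tle t u -> tle u v -> tle t v.
Proof.
  intros H1 H2 p l E. destruct (H1 p l E) as [[-> N]|E']; [|auto].
  left. split; auto. destruct (u p) as [l'|] eqn:E'; [|congruence].
  destruct (H2 p l' E') as [[_ ?]|]; congruence.
Qed.

Lemma tle_bot {X} (t : tree Sig X) : t [] <> None -> tle (leaf_tree NBot) t.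
Proof. intros N [|i p] l; simpl; intros E; inversion E; auto. Qed.

Lemma tle_node_tree {X} (l : node Sig X) ch ch' :
  (forall i u, ch i = Some u -> exists u', ch' i = Some u' /\ tle u u') ->
  tle (node_tree l ch) (node_tree l ch').
Proof.
  intros H [|i p] l'; simpl; auto.
  destruct (ch i) as [u|] eqn:E; [|discriminate].
  destruct (H i u E) as (u' & -> & Hu). apply Hu.
Qed.

Lemma tle_restrict {X} (P : X -> Prop) (t t' : tree Sig X) :
  tle t t' -> tle (restrict t P) (restrict t' P).
Proof.
  intros H p l. rewrite !restrictE. destruct (t p) as [l0|] eqn:E; [|discriminate].
  intros [= <-]. destruct (H p l0 E) as [[-> N]| ->]; auto.
  left. split; auto. now destruct (t' p).
Qed.

Lemma tle_restrict_sub {X} (L P P' : X -> Prop) (t : tree Sig X) :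
  wf_tree ar L t -> (forall x, L x -> P x -> P' x) -> tle (restrict t P) (restrict t P').
Proof.
  intros (_ & HL & _) H p l. rewrite !restrictE. destruct (t p) as [l0|] eqn:E; [|discriminate].
  intros [= <-]. apply HL in E. destruct l0; simpl in *; auto.
  repeat destruct excluded_middle_informative; auto.
  - exfalso; eauto.
  - left; split; auto; discriminate.
Qed.

Lemma restrict_bot {X} (P : X -> Prop) :
  restrict (leaf_tree (NBot : node Sig X)) P = leaf_tree NBot.
Proof. extensionality p. now destruct p. Qed.

Lemma map_bot {X Y} (f : X -> Y) : map_tree f (leaf_tree NBot) = leaf_tree NBot.
Proof. extensionality p. now destruct p. Qed.

(** * Flattening of trees of trees *)

Lemma muf_cons (r : tree Sig (tree Sig unit)) i q p :
  muf r (i :: q) p = muf (fun q => r (i :: q)) q p.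
Proof.
  revert q. induction p as [|j p IH]; intros q; simpl; destruct (r (i :: q)) as [[]|]; auto;
  apply (IH (q ++ [j])).
Qed.

Lemma mu_leaf t ch : mu (node_tree (NLeaf t) ch) = t.
Proof. extensionality p. now destruct p. Qed.

Lemma mu_bot ch : mu (node_tree NBot ch) = leaf_tree NBot.
Proof. extensionality p. now destruct p. Qed.

Lemma mu_map_leaf {X} (f : X -> tree Sig unit) x ch :
  mu (map_tree f (node_tree (NLeaf x) ch)) = f x.
Proof. rewrite map_node_tree. apply mu_leaf. Qed.

Lemma mu_map_bot {X} (f : X -> tree Sig unit) : mu (map_tree f (leaf_tree NBot)) = leaf_tree NBot.
Proof. rewrite map_bot. apply mu_bot. Qed.

Definition is_op {X} (l : node Sig X) : Prop :=
  match l with NOp _ | NOpM _ _ => True | _ => False end.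

(** Operation labels do not depend on the leaf type; leaves are sent to the default [NBot]. *)
Definition cast_node {X Y} (l : node Sig X) : node Sig Y :=
  match l with NOp s => NOp s | NOpM s m => NOpM s m | _ => NBot end.

Lemma op_restrict {X} (P : X -> Prop) l : is_op l -> restrict_node P l = cast_node l.
Proof. now destruct l. Qed.

Lemma cast_map {X Y Z} (f : X -> Y) l : cast_node (map_node f l) = cast_node l :> node Sig Z.
Proof. now destruct l. Qed.

Lemma is_op_map {X Y} (f : X -> Y) l : is_op l -> is_op (map_node f l).
Proof. now destruct l. Qed.

Lemma mu_op l ch : is_op l ->
  mu (node_tree l ch) = node_tree (cast_node l) (fun i => option_map mu (ch i)).
Proof.
  intros Hl. extensionality p. destruct l; simpl in *; try tauto; unfold mu;
  destruct p as [|i p]; simpl; auto; rewrite muf_cons; simpl;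
  (destruct (ch i); simpl; auto; now destruct p).
Qed.

Lemma wf_mu r : TT1 ar r -> T1 ar (mu r).
Proof.
  intros H.
  (* The second disjunct is entered once the descent has crossed a leaf of the outer tree and
     continues inside an inner one. *)
  apply wf_coind with (Q := fun u => (exists r, TT1 ar r /\ u = mu r) \/ T1 ar u).
  2: eauto.
  clear. intros u [[r [H ->]]|H].
  - destruct (wf_inv _ _ H) as (l & ch & -> & Hl & Hc & Hw).
    destruct l as [t| |s|s m].
    { rewrite mu_leaf. destruct (wf_inv _ _ Hl) as (l & ch' & -> & ? & ? & ?).
      exists l, ch'. unfold T1; eauto 7. }
    { rewrite mu_bot. exists NBot, (fun _ => None). repeat split; simpl; auto; easy. }
    all: rewrite mu_op by exact I; eexists _, _; split; [reflexivity|]; repeat split; auto.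
    1, 4: intros C%(Hc i); now destruct (ch i).
    1, 3: intros N; apply (Hc i); now destruct (ch i).
    all: intros i u E; destruct (ch i) as [t|] eqn:Ei; [injection E as <-|discriminate];
      left; exists t; split; [exact (Hw i t Ei)|reflexivity].
  - destruct (wf_inv _ _ H) as (l & ch & -> & ? & ? & ?). exists l, ch. unfold T1; eauto 7.
Qed.

(** The total family [c] is cut down to the indices allowed by the arity of [l], so that the
    condition on children in [wf_tree] holds by construction. *)
Definition op_tree {X} (l : node Sig X) (c : nat -> tree Sig X) : tree Sig X :=
  node_tree l (fun i => if excluded_middle_informative (child_ok ar l i)
                        then Some (c i) else None).

Lemma wf_op_tree {X} (L : X -> Prop) l c :
  label_ok ar L l -> (forall i, child_ok ar l i -> wf_tree ar L (c i)) ->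
  wf_tree ar L (op_tree l c).
Proof.
  intros Hl Hw. apply wf_node_tree; auto.
  - intros i. destruct excluded_middle_informative; split; congruence || tauto.
  - intros i u. destruct excluded_middle_informative; intros [= <-]; auto.
Qed.

(** * Lifting relations to trees *)

Context {O : Type} (interp : O -> tree Sig unit -> Prop).
Hypothesis Hscott : forall o, scott_open ar (interp o).
Hypothesis Hdec : decomposable ar interp.

(** The relator induced by the modalities: what $o$ observes of [t] at [P] it observes of [t'] at
    the image of [P] under [S]. A simulation is a relation contained in its own lifting. *)
Definition lift {X Y} (S : X -> Y -> Prop) (t : tree Sig X) (t' : tree Sig Y) : Prop :=
  forall o (P : X -> Prop), interp o (restrict t P) ->
    interp o (restrict t' (fun y => exists x, P x /\ S x y)).

Lemma interp_mono o t t' : T1 ar t -> T1 ar t' -> tle t t' -> interp o t -> interp o t'.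
Proof. apply (Hscott o). Qed.

Lemma interp_restrict_sub {X} (L P P' : X -> Prop) o t :
  wf_tree ar L t -> (forall x, L x -> P x -> P' x) ->
  interp o (restrict t P) -> interp o (restrict t P').
Proof. intros. eapply interp_mono; eauto using wf_restrict, tle_restrict_sub. Qed.

Lemma lift_sub {X Y} (L' : Y -> Prop) (S S' : X -> Y -> Prop) t t' :
  wf_tree ar L' t' -> (forall x y, S x y -> S' x y) -> lift S t t' -> lift S' t t'.
Proof.
  intros W H HS o P Hi. eapply interp_restrict_sub; [eauto| |apply HS, Hi].
  firstorder.
Qed.

Lemma lift_comp {X Y Z} (L : Z -> Prop) (S : X -> Y -> Prop) (S' : Y -> Z -> Prop) t u v :
  wf_tree ar L v -> lift S t u -> lift S' u v ->
  lift (fun x z => exists y, S x y /\ S' y z) t v.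
Proof.
  intros W H H' o P Hi. eapply interp_restrict_sub; [eauto| |apply H', H, Hi].
  firstorder.
Qed.

Lemma lift_refl {X} (L : X -> Prop) (S : X -> X -> Prop) t :
  wf_tree ar L t -> (forall x, L x -> S x x) -> lift S t t.
Proof. intros W H o P. apply interp_restrict_sub with L; eauto. Qed.

Lemma lift_tle {X Y} (L : X -> Prop) (S : X -> Y -> Prop) t u v :
  wf_tree ar L t -> wf_tree ar L u -> tle t u -> lift S u v -> lift S t v.
Proof.
  intros Wt Wu H HS o P Hi. apply HS.
  eapply interp_mono; [..|exact Hi]; eauto using wf_restrict, tle_restrict.
Qed.

(** The class is generated from its atoms by unions and intersections only, so preserving atoms
    suffices; the atom $o(\top)$ is [interp o] itself, since restriction to all leaves is the
    identity. *)
Lemma tri_intro t t' :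
  (forall o, interp o t -> interp o t') ->
  (forall o, interp o (restrict t (fun _ => False)) ->
             interp o (restrict t' (fun _ => False))) ->
  tri interp t t'.
Proof.
  intros H1 H2 F. induction F; simpl; unfold omod; rewrite ?restrict_full; auto;
  firstorder.
Qed.

Lemma tri_tle t t' : T1 ar t -> T1 ar t' -> tle t t' -> tri interp t t'.
Proof.
  intros W W' H. apply tri_intro; intros o; apply interp_mono;
  eauto using wf_restrict, tle_restrict.
Qed.

(** The atom $o(\top)$ is the lifting at [P], the atom $o(\bot)$ is the lifting at the empty
    predicate, whose [S]-image is empty. *)
Lemma lift_tri {X Y} (L' : Y -> Prop) (S : X -> Y -> Prop) (P : X -> Prop) t t' :
  wf_tree ar L' t' -> lift S t t' ->
  tri interp (restrict t P) (restrict t' (fun y => exists x, P x /\ S x y)).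
Proof.
  intros W H. apply tri_intro; intros o; [apply H|].
  rewrite !restrict_restrict. intros Hi%H. revert Hi.
  apply interp_restrict_sub with L'; firstorder.
Qed.

Lemma tri_lift {X Y} (S : X -> Y -> Prop) (t : tree Sig X) (t' : tree Sig Y) :
  (forall P : X -> Prop,
     tri interp (restrict t P) (restrict t' (fun y => exists x, P x /\ S x y))) ->
  lift S t t'.
Proof.
  intros H o P Hi. specialize (H P (TTop o)). simpl in H. unfold omod in H.
  rewrite !restrict_full in H. auto.
Qed.

(** This is where decomposability is applied. A formula [F] holding of [f x] defines a predicate on
    the leaves of [t]; the lifting carries it to the [S]-image, and on that image [F] holds of [g y]
    by the hypothesis on [f] and [g]. *)
Lemma bind_tri {X Y} (L : X -> Prop) (L' : Y -> Prop) (S : X -> Y -> Prop) t t' f g :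
  wf_tree ar L t -> wf_tree ar L' t' -> lift S t t' ->
  (forall x, L x -> T1 ar (f x)) -> (forall y, L' y -> T1 ar (g y)) ->
  (forall x y, S x y -> tri interp (f x) (g y)) ->
  tri interp (mu (map_tree f t)) (mu (map_tree g t')).
Proof.
  intros W W' HS Hf Hg Hfg. apply Hdec; [eapply wf_map; eauto ..|].
  intros o F. unfold omod. rewrite !restrict_map. intros Hi%HS. revert Hi.
  apply interp_restrict_sub with L'; auto. intros y _ (x & Hx & Hxy). exact (Hfg x y Hxy F Hx).
Qed.

(** An operation node is the flattening of a tree of depth one whose leaves are the child indices,
    with the children grafted on them; so this is [bind_tri] for equality of indices. *)
Lemma op_tri (l : node Sig unit) c c' :
  is_op l -> label_ok ar (fun _ => True) l ->
  (forall i, child_ok ar l i -> T1 ar (c i)) ->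
  (forall i, child_ok ar l i -> T1 ar (c' i)) ->
  (forall i, child_ok ar l i -> tri interp (c i) (c' i)) ->
  tri interp (op_tree l c) (op_tree l c').
Proof.
  intros Hop Hl W W' H.
  set (t := op_tree (cast_node l : node Sig nat) (fun i => leaf_tree (NLeaf i))).
  assert (E : forall d, op_tree l d = mu (map_tree d t)).
  { intros d. unfold t, op_tree. rewrite map_node_tree, mu_op by now destruct l.
    replace (cast_node (map_node d (cast_node l))) with l by now destruct l.
    f_equal. extensionality i.
    replace (child_ok ar (cast_node l : node Sig nat) i) with (child_ok ar l i)
      by now destruct l.
    destruct excluded_middle_informative; simpl; auto.
    unfold leaf_tree. rewrite map_node_tree. symmetry. f_equal. apply mu_leaf. }
  assert (Wt : wf_tree ar (child_ok ar l) t).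
  { apply wf_op_tree; [now destruct l|]. intros i Hi.
    apply wf_leaf_tree; simpl; auto. now destruct l. }
  rewrite !E. apply bind_tri with (L := child_ok ar l) (L' := child_ok ar l)
    (S := fun i j => i = j /\ child_ok ar l i); auto.
  - eapply lift_refl; eauto.
  - intros i j [<- Hi]; auto.
Qed.
End Trees.

(** * Evaluation *)

Section Evaluation.
Context {Sig : Type} (ar : Sig -> arity).
Implicit Types (K : list (com Sig)) (M N : com Sig) (V : val Sig) (c d : config Sig).

(** Reduction as a function: determinism is immediate and single steps compute. *)
Definition stepf c : option (config Sig) :=
  let (K, M) := c in
  match M with
  | CApp (VLam _ M) V => Some (K, subst1 M V)
  | CCase VZ M _ => Some (K, M)
  | CCase (VS V) _ N => Some (K, subst1 N V)
  | CFix (VLam (tArr a b) M) => Some (K, CRet (fix_unfold a (VLam (tArr a b) M)))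
  | CLet M N => Some (N :: K, M)
  | CRet V => match K with N :: K => Some (K, subst1 N V) | [] => None end
  | _ => None
  end.

Lemma stepE c d : step c d <-> stepf c = Some d.
Proof.
  split.
  { now destruct 1. }
  destruct c as [K [V W|V|M N|V|V M N| | | |]]; simpl; try (now destruct K);
  try (destruct V as [| | |[]|]); try (destruct K); intros [= <-]; constructor.
Qed.

Lemma terminal_stepf c : terminal c -> stepf c = None.
Proof. now destruct c as [[|] []]. Qed.

Definition evals : relation (config Sig) := clos_refl_trans _ (@step Sig).

Lemma evals_det c d d' : evals c d -> terminal d -> evals c d' -> terminal d' -> d = d'.
Proof.
  intros H%clos_rt_rt1n T H' T'. apply clos_rt_rt1n in H'. revert T d' H' T'.
  induction H as [c|c e d H _ IH]; intros T d' H' T'.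
  - apply terminal_stepf in T. destruct H' as [|? ? H']; auto.
    apply stepE in H'. congruence.
  - apply stepE in H. destruct H' as [|? ? H'].
    + apply terminal_stepf in T'. congruence.
    + apply stepE in H'. replace y with e in * by congruence. auto.
Qed.

Lemma next_some c d : next c = Some d <-> evals c d /\ terminal d.
Proof.
  unfold next. destruct excluded_middle_informative as [E|E].
  - destruct constructive_indefinite_description as [e [He Te]]; simpl. split.
    + intros [= ->]; auto.
    + intros [Hd Td]. f_equal. eapply evals_det; eauto.
  - split; [discriminate|]. intros [Hd Td]. destruct E; eauto.
Qed.

Lemma next_step c d : stepf c = Some d -> next c = next d.
Proof.
  intros E. assert (H : forall e, next c = Some e <-> next d = Some e).
  { intros e. rewrite !next_some.
    enough (terminal e -> evals c e <-> evals d e) by tauto. intros Te. split.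
    - intros H%clos_rt_rt1n. destruct H as [|? ? H H'].
      + apply terminal_stepf in Te. congruence.
      + apply stepE in H. replace y with d in * by congruence.
        now apply clos_rt1n_rt.
    - intros H. apply rt_trans with d; auto. now apply rt_step, stepE. }
  destruct (next d) as [e|] eqn:Ed.
  - now apply H.
  - destruct (next c) as [e|]; auto. symmetry. now apply H.
Qed.

Lemma next_terminal c : terminal c -> next c = Some c.
Proof. intros T. apply next_some. split; auto. apply rt_refl. Qed.

Definition config_tree c : tree Sig (val Sig) := fun p => tree_of_config p c.

Lemma config_treeE c :
  config_tree c =
  match next c with
  | None => leaf_tree NBot
  | Some d => node_tree (label_of d) (fun i => option_map config_tree (child_of d i))
  end.
Proof.
  extensionality p. unfold config_tree.
  destruct p as [|i p]; simpl; destruct (next c) as [d|]; auto.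
  simpl. now destruct (child_of d i).
Qed.

Lemma config_tree_step c d : stepf c = Some d -> config_tree c = config_tree d.
Proof. intros E. now rewrite (config_treeE c), (config_treeE d), (next_step _ _ E). Qed.

Lemma config_tree_terminal c : terminal c ->
  config_tree c = node_tree (label_of c) (fun i => option_map config_tree (child_of c i)).
Proof. intros T. now rewrite config_treeE, next_terminal. Qed.

(* The fuel [n] is spent both on reductions and on descending below operations. *)
Fixpoint approx n c : tree Sig (val Sig) :=
  match n with
  | 0 => leaf_tree NBot
  | S n =>
      match stepf c with
      | Some d => approx n d
      | None => node_tree (label_of c) (fun i => option_map (approx n) (child_of c i))
      end
  end.

(** * Type preservation and progress for configurations *)

Inductive stack_typed : list (com Sig) -> ty -> ty -> Prop :=
| stack_nil t : stack_typed [] t t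
| stack_cons N K a b t : ctyped ar [a] N b -> stack_typed K b t -> stack_typed (N :: K) a t.

Definition config_typed c t : Prop :=
  exists a, stack_typed (fst c) a t /\ ctyped ar [] (snd c) a.

Lemma typed_step c d t : config_typed c t -> stepf c = Some d -> config_typed d t.
Proof.
  intros (a & HK & HM) E%stepE.
  destruct E; simpl in *; inversion HM; subst;
  try match goal with H : stack_typed (_ :: _) _ _ |- _ => inversion H; subst end;
  eexists; (split; [eassumption || (econstructor; eassumption)|]); simpl; auto.
  - match goal with H : vtyped _ _ (VLam _ _) _ |- _ => inversion H; subst end.
    eapply typed_subst1; eauto.
  - match goal with H : vtyped _ _ (VS _) _ |- _ => inversion H; subst end.
    eapply typed_subst1; eauto.
  - match goal with H : vtyped _ _ (VLam _ _) _ |- _ => pose proof H; inversion H; subst end.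
    constructor. eapply fix_unfold_typed; eauto.
  - eapply typed_subst1; eauto.
Qed.

Ltac canonical := repeat match goal with
  | H : vtyped ar [] ?V tN |- _ =>
      is_var V; let n := fresh "n" in destruct (closed_nat _ _ H) as [n ->]
  | H : vtyped ar [] ?V (tArr _ _) |- _ =>
      is_var V; destruct (closed_arrow _ _ _ _ H) as (? & -> & ?)
  end.

Lemma progress c t : config_typed c t -> stepf c <> None \/ terminal c.
Proof.
  destruct c as [K M]. intros (a & HK & HM); simpl in *.
  inversion HM; subst; canonical; simpl; rewrite ?num_of_numeral; auto; try (left; discriminate).
  - destruct K; auto. left; discriminate.
  - destruct n; left; discriminate.
  - right. now destruct K.
  - right. now destruct K.
  - right. now destruct K.
  - right. now destruct K.
Qed.

Definition leaf_typed t V : Prop := vtyped ar [] V t.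

Lemma label_typed c t : config_typed c t -> label_ok ar (leaf_typed t) (label_of c).
Proof.
  destruct c as [K M]. intros (a & HK & HM); simpl in *.
  inversion HM; subst; canonical; destruct K; simpl; auto;
  rewrite ?num_of_numeral; simpl; try match goal with H : ar _ = _ |- _ => now rewrite H end.
  inversion HK; subst; auto.
Qed.

Lemma child_iff c t i : config_typed c t -> terminal c ->
  child_ok ar (label_of c) i <-> child_of c i <> None.
Proof.
  destruct c as [K M]. intros (a & HK & HM) T; simpl in *.
  assert (L : forall Ms : list (com Sig),
    i < length Ms <-> match nth_error Ms i with Some M => Some (K, M) | None => None end <> None).
  { intros Ms. rewrite <- nth_error_Some. now destruct nth_error. }
  inversion HM; subst; canonical; destruct K; simpl in *; try tauto;
  rewrite ?num_of_numeral; simpl; try match goal with H : ar _ = _ |- _ => rewrite H end;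
  auto; split; congruence || tauto.
Qed.

Lemma child_typed c t i d : config_typed c t -> child_of c i = Some d -> config_typed d t.
Proof.
  destruct c as [K M]. intros (a & HK & HM) E; simpl in *.
  exists a.
  inversion HM; subst; destruct K; simpl in E; try discriminate;
  try (destruct (nth_error Ms i) eqn:Ei; [apply nth_error_In in Ei|discriminate]);
  injection E as <-; simpl; split; auto; econstructor; eauto using numeral_typed.
Qed.

Lemma typed_evals c d t : config_typed c t -> evals c d -> config_typed d t.
Proof.
  intros H E%clos_rt_rt1n. induction E; auto. apply IHE. eapply typed_step; eauto. now apply stepE.
Qed.

Lemma wf_config_tree c t : config_typed c t -> wf_tree ar (leaf_typed t) (config_tree c).
Proof.
  intros H. apply wf_coind with (Q := fun u => exists c, config_typed c t /\ u = config_tree c).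
  2: eauto.
  clear. intros ? [c [H ->]]. rewrite config_treeE. destruct (next c) as [d|] eqn:E.
  - apply next_some in E as [E Td]. apply (typed_evals _ _ _ H) in E.
    eexists _, _. split; [reflexivity|]. split; [now apply label_typed|]. split.
    + intros i. rewrite child_iff by eauto. now destruct (child_of d i).
    + intros i u Eu. destruct (child_of d i) as [e|] eqn:Ei; [injection Eu as <-|discriminate].
      exists e. eauto using child_typed.
  - exists NBot, (fun _ => None). repeat split; simpl; auto; easy.
Qed.

Lemma wf_approx n c t : config_typed c t -> wf_tree ar (leaf_typed t) (approx n c).
Proof.
  revert c. induction n as [|n IH]; intros c H; simpl; [apply wf_bot|].
  destruct (stepf c) as [d|] eqn:E; [eauto using typed_step|].
  destruct (progress _ _ H) as [|T]; [congruence|].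
  apply wf_node_tree.
  - now apply label_typed.
  - intros i. rewrite child_iff by eauto. now destruct (child_of c i).
  - intros i u Eu. destruct (child_of c i) as [e|] eqn:Ei; [injection Eu as <-|discriminate].
    eauto using child_typed.
Qed.

Lemma approx_S n c : tle (approx n c) (approx (S n) c).
Proof.
  revert c. induction n as [|n IH]; intros c.
  - simpl. apply tle_bot. destruct (stepf c); discriminate.
  - change (tle (match stepf c with
                 | Some d => approx n d
                 | None => node_tree (label_of c) (fun i => option_map (approx n) (child_of c i))
                 end)
                (match stepf c with
                 | Some d => approx (S n) d
                 | None => node_tree (label_of c) (fun i => option_map (approx (S n)) (child_of c i))
                 end)).
    destruct (stepf c); auto. apply tle_node_tree. intros i u.
    destruct (child_of c i); [|discriminate]. intros [= <-]. eexists; split; [reflexivity|apply IH].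
Qed.

Lemma approx_le n m c : n <= m -> tle (approx n c) (approx m c).
Proof. induction 1; eauto using tle_refl, tle_trans, approx_S. Qed.

Lemma approx_diverges n c t : config_typed c t -> next c = None -> approx n c = leaf_tree NBot.
Proof.
  revert c. induction n as [|n IH]; intros c H E; simpl; auto.
  destruct (progress _ _ H) as [N|T].
  - destruct (stepf c) eqn:Ec; [|congruence]. apply IH; eauto using typed_step.
    now rewrite <- (next_step _ _ Ec).
  - apply next_terminal in T. congruence.
Qed.

Lemma approx_evals c d : evals c d -> exists k, forall n, approx (k + n) c = approx n d.
Proof.
  intros H%clos_rt_rt1n. induction H as [|c d e H _ [k Hk]].
  - now exists 0.
  - exists (S k). intros n. simpl. apply stepE in H. now rewrite H.
Qed.

(** Each position stabilises after finitely many approximants, so suprema can be computed position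
    by position. *)
Lemma approx_limit p c t : config_typed c t ->
  exists k, forall n, k <= n -> approx n c p = config_tree c p.
Proof.
  revert c. induction p as [|i p IH]; intros c H; rewrite config_treeE;
  (destruct (next c) as [d|] eqn:E; [|exists 0; intros; now rewrite (approx_diverges _ _ _ H E)]);
  apply next_some in E as [E Td]; pose proof (typed_evals _ _ _ H E) as Hd;
  destruct (approx_evals _ _ E) as [k Hk]; pose proof (terminal_stepf _ Td) as Sd.
  - exists (k + 1). intros n L. replace n with (k + S (n - k - 1)) by lia. rewrite Hk.
    simpl. now rewrite Sd.
  - simpl. destruct (child_of d i) as [e|] eqn:Ei.
    + destruct (IH e) as [k' Hk']; [eauto using child_typed|].
      (* [k] units reach the terminal configuration [d], one is spent on its node, and [k'] are left
         for the child [e]. *)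
      exists (k + S k'). intros n L. replace n with (k + S (n - k - 1)) by lia. rewrite Hk.
      simpl. rewrite Sd. simpl. rewrite Ei. simpl. apply Hk'. lia.
    + exists (k + 1). intros n L. replace n with (k + S (n - k - 1)) by lia. rewrite Hk.
      simpl. rewrite Sd. simpl. now rewrite Ei.
Qed.

Lemma approx_sup (P : val Sig -> Prop) c t : config_typed c t ->
  is_sup ar (fun n => restrict (approx n c) P) (restrict (config_tree c) P).
Proof.
  intros H. split.
  - intros n. apply tle_restrict. intros p l E.
    destruct (approx_limit p _ _ H) as [k Hk].
    rewrite <- (Hk (max k n)) by lia. apply (approx_le n (max k n) c); [lia|auto].
  - intros u _ Hu p l E. destruct (approx_limit p _ _ H) as [k Hk].
    apply (Hu k p l). rewrite restrictE, Hk by lia. now rewrite restrictE in E.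
Qed.

Lemma stepf_stack K M K' M' N :
  stepf (K, M) = Some (K', M') -> stepf (K ++ [N], M) = Some (K' ++ [N], M').
Proof.
  rewrite <- !stepE. intros H. inversion H; subst; simpl; constructor.
Qed.

Lemma evals_stack K M K' M' N :
  evals (K, M) (K', M') -> evals (K ++ [N], M) (K' ++ [N], M').
Proof.
  intros H%clos_rt_rt1n. remember (K, M) as c. remember (K', M') as d.
  revert K M Heqc. induction H as [|c e d H _ IH]; intros K M ->.
  - injection Heqd as -> ->. apply rt_refl.
  - destruct e as [K1 M1]. apply rt_trans with (K1 ++ [N], M1).
    + apply rt_step, stepE, stepf_stack. now apply stepE.
    + apply IH; auto.
Qed.

Lemma evals_tree c d : evals c d -> config_tree c = config_tree d.
Proof.
  intros H%clos_rt_rt1n. induction H as [|c e d H _ IH]; auto.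
  rewrite <- IH. apply config_tree_step. now apply stepE.
Qed.

(** Evaluation stops either with a value for the frame appended at the bottom of the stack, or at an
    operation, whose label ignores the stack and whose children inherit the frame. These are the two
    cases of sequencing. *)
Lemma terminal_stack K M : terminal (K, M) ->
  (K = [] /\ exists V, M = CRet V) \/
  (is_op (label_of (K, M)) /\ forall N,
     terminal (K ++ [N], M) /\ label_of (K ++ [N], M) = label_of (K, M) /\
     forall i, child_of (K ++ [N], M) i =
       option_map (fun d => (fst d ++ [N], snd d)) (child_of (K, M) i)).
Proof.
  intros T.
  destruct M; try (destruct K; now simpl in *);
  [left; destruct K; simpl in *; try tauto; eauto|right..];
  (destruct K; simpl in *; try (destruct num_of; simpl in *; [|congruence]);
   repeat split; auto; try congruence; intros; destruct nth_error; auto).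
Qed.
End Evaluation.

(** * Sequencing and operations as flattenings *)

Section Sequencing.
Context {Sig : Type} (ar : Sig -> arity) {O : Type} (interp : O -> tree Sig unit -> Prop).
Hypothesis Hscott : forall o, scott_open ar (interp o).
Hypothesis Hdec : decomposable ar interp.
Implicit Types (K : list (com Sig)) (M N : com Sig) (V : val Sig) (c d : config Sig).

(** On the left a single budget [n] is shared between [M] and the continuation; on the right each of
    the two gets a budget of its own, so only an inequality holds. Keeping [m] fixed lets the
    induction run on [n]. *)
Lemma approx_bind (P : val Sig -> Prop) m n K M N a :
  config_typed ar (K, M) a -> n <= m ->
  tle (restrict (approx n (K ++ [N], M)) P)
      (mu (map_tree (fun V => restrict (approx m ([], subst1 N V)) P) (approx n (K, M)))).
Proof.
  revert K M. induction n as [|n IH]; intros K M H L.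
  { simpl. rewrite restrict_bot, mu_map_bot. apply tle_refl. }
  destruct (stepf (K, M)) as [[K' M']|] eqn:E.
  - cbn [approx]. rewrite E, (stepf_stack _ _ _ _ _ E). apply IH; [|lia].
    eapply typed_step; eauto.
  - destruct (progress _ _ _ H) as [|T]; [congruence|].
    destruct (terminal_stack _ _ T) as [[-> [V ->]]|[Hop HN]].
    + cbn [approx stepf app label_of]. rewrite mu_map_leaf.
      apply tle_restrict, approx_le. lia.
    + destruct (HN N) as (TN & LN & CN).
      cbn [approx]. rewrite E, (terminal_stepf _ TN), LN.
      rewrite map_node_tree, restrict_node_tree, mu_op, cast_map, op_restrict
        by auto using is_op_map.
      apply tle_node_tree. intros i u. rewrite CN.
      destruct (child_of (K, M) i) as [[K' M']|] eqn:Ei; [|discriminate].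
      intros [= <-]. eexists; split; [reflexivity|]. apply IH; [|lia].
      eapply child_typed; eauto.
Qed.

Lemma config_tree_bind (P : val Sig -> Prop) K M N :
  tle (mu (map_tree (fun V => restrict (config_tree ([], subst1 N V)) P)
                    (config_tree (K, M))))
      (restrict (config_tree (K ++ [N], M)) P).
Proof.
  intros p. revert K M. induction p as [|i p IH]; intros K M l;
  rewrite (config_treeE (K, M));
  (destruct (next (K, M)) as [[K' M']|] eqn:E;
   [apply next_some in E as [E T]; rewrite (evals_tree _ _ (evals_stack _ _ _ _ N E));
    destruct (terminal_stack _ _ T) as [[-> [V ->]]|[Hop HN]];
    [|destruct (HN N) as (TN & LN & CN);
      rewrite (config_tree_terminal _ TN), LN, map_node_tree, restrict_node_tree, mu_op,
        cast_map, op_restrict by auto using is_op_map]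
   |rewrite mu_map_bot]).
  - cbn [label_of app]. rewrite mu_map_leaf, (config_tree_step ([N], CRet V) _ eq_refl). auto.
  - auto.
  - simpl. intros [= <-]. left. split; auto. rewrite restrictE, config_treeE.
    now destruct (next (K ++ [N], M)).
  - cbn [label_of app]. rewrite mu_map_leaf, (config_tree_step ([N], CRet V) _ eq_refl). auto.
  - unfold node_tree. rewrite CN. destruct (child_of (K', M') i) as [[K1 M1]|]; simpl; auto.
  - discriminate.
Qed.

Lemma lift_bot {X Y} (L : Y -> Prop) (S : X -> Y -> Prop) t :
  wf_tree ar L t -> lift interp S (leaf_tree NBot) t.
Proof.
  intros W o P. apply (interp_mono _ _ Hscott); [| |]; rewrite ?restrict_bot.
  - apply wf_bot.
  - eapply wf_restrict; eauto.
  - apply tle_bot. rewrite restrictE. destruct W as [W _]. now destruct (t []).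
Qed.

(** If a modality holds of the restricted limit, Scott-openness yields an approximant of which it
    already holds, and the lifting is known there. *)
Lemma lift_limit {Y} (S : val Sig -> Y -> Prop) c a t :
  config_typed ar c a -> (forall n, lift interp S (approx n c) t) ->
  lift interp S (config_tree c) t.
Proof.
  intros H HS o P Hi.
  destruct (Hscott o) as [_ Hopen].
  destruct (Hopen (fun n => restrict (approx n c) P) (restrict (config_tree c) P)) as [n Hn];
  auto.
  - intros n. eapply wf_restrict, wf_approx; eauto.
  - intros n. apply tle_restrict, approx_S.
  - eapply wf_restrict, wf_config_tree; eauto.
  - eapply approx_sup; eauto.
  - eapply HS; eauto.
Qed.

(** Makes liftings between whole trees, as given by [Rc_lift], usable in [lift_let] and [lift_op],
    which have approximants on the left. *)
Lemma lift_approx {Y} (S : val Sig -> Y -> Prop) n c a t :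
  config_typed ar c a -> lift interp S (config_tree c) t ->
  lift interp S (approx n c) t.
Proof.
  intros H. eapply lift_tle; eauto using wf_config_tree, wf_approx.
  intros p l E. destruct (approx_limit _ p _ _ H) as [k Hk].
  rewrite <- (Hk (max k n)) by lia. apply (approx_le n (max k n) c); [lia|auto].
Qed.

Lemma closed_config M a : ctyped ar [] M a -> config_typed ar ([], M) a.
Proof. exists a. split; auto. constructor. Qed.

Lemma let_config M N a b :
  ctyped ar [] M a -> ctyped ar [a] N b -> config_typed ar ([N], M) b.
Proof. exists a. split; auto. econstructor; eauto. constructor. Qed.

Lemma lift_let (S S' : val Sig -> val Sig -> Prop) n M M' N N' a b :
  ctyped ar [] M a -> ctyped ar [] M' a -> ctyped ar [a] N b -> ctyped ar [a] N' b ->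
  lift interp S (approx n ([], M)) (config_tree ([], M')) ->
  (forall V V', S V V' -> vtyped ar [] V a -> vtyped ar [] V' a ->
     lift interp S' (approx n ([], subst1 N V)) (config_tree ([], subst1 N' V'))) ->
  lift interp S' (approx n ([N], M)) (config_tree ([N'], M')).
Proof.
  intros HM HM' HN HN' HS HS'.
  pose proof (closed_config _ _ HM) as CM. pose proof (closed_config _ _ HM') as CM'.
  pose proof (let_config _ _ _ _ HM HN) as CL. pose proof (let_config _ _ _ _ HM' HN') as CL'.
  assert (CN : forall V, vtyped ar [] V a -> config_typed ar ([], subst1 N V) b).
  { intros. eapply closed_config, typed_subst1; eauto. }
  assert (CN' : forall V, vtyped ar [] V a -> config_typed ar ([], subst1 N' V) b).
  { intros. eapply closed_config, typed_subst1; eauto. }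
  apply tri_lift. intros P.
  set (P' := fun y => exists x, P x /\ S' x y).
  set (f := fun V => restrict (approx n ([], subst1 N V)) P).
  set (g := fun V => restrict (config_tree ([], subst1 N' V)) P').
  assert (Wf : TT1 ar (map_tree f (approx n ([], M)))).
  { eapply wf_map; [|eapply wf_approx; eauto].
    intros V HV. eapply wf_restrict, wf_approx; eauto. }
  assert (Wg : TT1 ar (map_tree g (config_tree ([], M')))).
  { eapply wf_map; [|eapply wf_config_tree; eauto].
    intros V HV. eapply wf_restrict, wf_config_tree; eauto. }
  assert (T : tri interp (mu (map_tree f (approx n ([], M))))
                         (mu (map_tree g (config_tree ([], M'))))).
  { apply bind_tri with (ar := ar) (L := leaf_typed ar a) (L' := leaf_typed ar a)
      (S := fun V V' => S V V' /\ vtyped ar [] V a /\ vtyped ar [] V' a); auto.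
    - eapply wf_approx; eauto.
    - eapply wf_config_tree; eauto.
    (* All leaves on both sides are typed, so [S] may be cut down to typed pairs: [Q] is first
       intersected with typing on the left. *)
    - intros o Q Hi.
      assert (Hi' : interp o (restrict (approx n ([], M)) (fun x => Q x /\ vtyped ar [] x a))).
      { revert Hi. eapply interp_restrict_sub; eauto using wf_approx. }
      apply HS in Hi'. revert Hi'. eapply interp_restrict_sub; eauto using wf_config_tree.
      unfold leaf_typed. firstorder.
    - intros V HV. eapply wf_restrict, wf_approx; eauto.
    - intros V HV. eapply wf_restrict, wf_config_tree; eauto.
    - intros V V' (HV & HT & HT'). eapply lift_tri; eauto using wf_config_tree. }
  (* Sandwich: the approximant of the sequence lies below the flattening on the left, [T] passes to
     the flattening on the right, and that lies below the tree of the right-hand sequence. *)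
  intros F HF. eapply tri_tle; [eauto|..|apply T].
  - now apply wf_mu.
  - eapply wf_restrict, wf_config_tree; eauto.
  - apply config_tree_bind with (K := []).
  - eapply tri_tle; [eauto|..|exact HF].
    + eapply wf_restrict, wf_approx; eauto.
    + now apply wf_mu.
    + eapply approx_bind with (K := []); eauto.
Qed.

Lemma lift_op (S : val Sig -> val Sig -> Prop) n c c' a :
  config_typed ar c a -> config_typed ar c' a -> terminal c -> terminal c' ->
  is_op (label_of c) -> label_of c' = label_of c ->
  (forall i d d', child_of c i = Some d -> child_of c' i = Some d' ->
     lift interp S (approx n d) (config_tree d')) ->
  lift interp S (approx (Datatypes.S n) c) (config_tree c').
Proof.
  intros H H' T T' Hop HL HS.
  pose proof (label_typed _ _ _ H) as Lab.
  (* Both trees are brought to the form [op_tree] with the same label, [u] being [approx n] or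
     [config_tree]; the bottom leaf is a default outside the arity. *)
  assert (E : forall (P : val Sig -> Prop) (u : config Sig -> tree Sig (val Sig)) e,
    config_typed ar e a -> terminal e -> label_of e = label_of c ->
    restrict (node_tree (label_of e) (fun i => option_map u (child_of e i))) P =
    op_tree ar (cast_node (label_of c))
      (fun i => match child_of e i with
                | Some d => restrict (u d) P | None => leaf_tree NBot end)).
  { intros P u e He Te EL. rewrite restrict_node_tree. unfold op_tree.
    rewrite EL. replace (restrict_node P (label_of c)) with (cast_node (Y := unit) (label_of c))
      by now destruct (label_of c).
    f_equal. extensionality i. pose proof (child_iff _ _ _ i He Te) as C. rewrite EL in C.
    destruct excluded_middle_informative as [D|D].
    - destruct (child_of e i); simpl; auto. exfalso. apply C; auto. now destruct (label_of c).
    - destruct (child_of e i) eqn:Ei; simpl; auto. exfalso. apply D.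
      assert (C' : child_ok ar (label_of c) i) by (apply C; congruence).
      now destruct (label_of c). }
  apply tri_lift. intros P. cbn [approx]. rewrite (terminal_stepf _ T).
  rewrite (config_tree_terminal _ T'), !E by auto.
  assert (W : forall i e u (Q : val Sig -> Prop), config_typed ar e a ->
    (forall d, config_typed ar d a -> wf_tree ar (leaf_typed ar a) (u d)) ->
    T1 ar (match child_of e i with
           | Some d => restrict (u d) Q | None => leaf_tree NBot end)).
  { intros i e u Q He Hu. destruct (child_of e i) eqn:Ei; [|apply wf_bot].
    eapply wf_restrict, Hu, child_typed; eauto. }
  apply op_tri; auto.
  - now destruct (label_of c).
  - now destruct (label_of c).
  - intros. apply W; auto. intros. now apply wf_approx.
  - intros. apply W; auto. intros. now apply wf_config_tree.
  - intros i C.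
    assert (Hi : child_of c i <> None).
    { eapply child_iff; eauto. now destruct (label_of c). }
    assert (Hi' : child_of c' i <> None).
    { eapply child_iff; eauto. rewrite HL. now destruct (label_of c). }
    destruct (child_of c i) as [d|] eqn:Ei; [|congruence].
    destruct (child_of c' i) as [d'|] eqn:Ei'; [|congruence].
    eapply lift_tri; eauto. eapply wf_config_tree, child_typed; eauto.
Qed.

Lemma lift_ret (S : val Sig -> val Sig -> Prop) n V V' a :
  vtyped ar [] V a -> vtyped ar [] V' a -> S V V' ->
  lift interp S (approx n ([], CRet V)) (config_tree ([], CRet V')).
Proof.
  intros H H' HS.
  assert (C : forall U, vtyped ar [] U a -> config_typed ar ([], CRet U) a).
  { intros. apply closed_config. now constructor. }
  destruct n.
  - eapply lift_bot, wf_config_tree; eauto.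
  - intros o P. pose proof (C _ H) as CV. pose proof (C _ H') as CV'.
    apply (interp_mono _ _ Hscott).
    + eapply wf_restrict, wf_approx; eauto.
    + eapply wf_restrict, wf_config_tree; eauto.
    + cbn [approx stepf]. rewrite config_tree_terminal by exact I. cbn [label_of].
      rewrite !restrict_node_tree. simpl.
      destruct (excluded_middle_informative (P V)); [|apply tle_bot; discriminate].
      destruct excluded_middle_informative as [|N]; [apply tle_node_tree; discriminate|].
      destruct N; eauto.
Qed.
End Sequencing.

(** * The behavioural preorder *)

Section Behaviour.
Context {Sig : Type} (ar : Sig -> arity) {O : Type} (interp : O -> tree Sig unit -> Prop).
Hypothesis Hscott : forall o, scott_open ar (interp o).
Hypothesis Hdec : decomposable ar interp.
(* [neg] selects the logic: [True] gives V, [False] gives V+. *)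
Variable neg : Prop.
Implicit Types (K : list (com Sig)) (M N : com Sig) (V W : val Sig).

Definition frag_v (t : ty) (phi : VF ar O t) : Prop := neg \/ pos_v phi.
Definition frag_c (t : ty) (Phi : CF ar O t) : Prop := neg \/ pos_c Phi.
Notation Rv := (le_L_v ar interp frag_v).
Notation Rc := (le_L_c ar interp frag_c).

Lemma Rv_refl t V : vtyped ar [] V t -> Rv t V V.
Proof. repeat split; auto. Qed.

Lemma Rv_trans t U V W : Rv t U V -> Rv t V W -> Rv t U W.
Proof. intros (? & ? & ?) (? & ? & ?). repeat split; auto. Qed.

Lemma Rc_trans t L M N : Rc t L M -> Rc t M N -> Rc t L N.
Proof. intros (? & ? & ?) (? & ? & ?). repeat split; auto. Qed.

(** The negation of a formula that holds of [W] and fails of [V] would refute [Rv t V W]. *)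
Lemma Rv_sym t V W : neg -> Rv t V W -> Rv t W V.
Proof.
  intros n (HV & HW & H). repeat split; auto. intros phi _ HphiW. apply NNPP. intros HphiV.
  apply (H (VNot phi)); simpl; auto. now left.
Qed.

Lemma Rc_sym t M N : neg -> Rc t M N -> Rc t N M.
Proof.
  intros n (HM & HN & H). repeat split; auto. intros Phi _ HN'. apply NNPP. intros HM'.
  apply (H (CNot Phi)); simpl; auto. now left.
Qed.

Lemma sat_c_tree t (Phi : CF ar O t) M N :
  eff_tree M = eff_tree N -> sat_c interp Phi M -> sat_c interp Phi N.
Proof.
  revert M N. induction Phi; simpl; intros M N E H'.
  - now rewrite <- E.
  - eauto.
  - destruct H' as [i Hi]. eauto.
  - intros H. apply H'. eapply IHPhi; eauto.
Qed.

Lemma Rc_tree t M N : ctyped ar [] M t -> ctyped ar [] N t ->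
  eff_tree M = eff_tree N -> Rc t M N.
Proof. intros. repeat split; eauto using sat_c_tree. Qed.

Lemma Rc_step t M N : ctyped ar [] M t -> stepf ([], M) = Some ([], N) -> Rc t M N.
Proof.
  intros H E. apply Rc_tree; auto.
  - destruct (typed_step _ _ _ _ (closed_config _ _ _ H) E) as (a & HK & HN).
    now inversion HK; subst.
  - exact (config_tree_step _ _ E).
Qed.

Lemma Rv_app a b V W A :
  Rv (tArr a b) V W -> vtyped ar [] A a -> Rc b (CApp V A) (CApp W A).
Proof.
  intros (HV & HW & H) HA. repeat split; try (econstructor; eauto).
  intros Phi HPhi. apply (H (VMaps (exist _ A HA) Phi)).
  destruct HPhi; [now left|now right].
Qed.

Lemma Rv_nat V W : Rv tN V W -> V = W.
Proof.
  intros (HV & HW & H). destruct (closed_nat _ _ HV) as [n ->].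
  symmetry. apply (H (VNum n)); [now right|reflexivity].
Qed.

Lemma wf_eff_tree M t : ctyped ar [] M t -> wf_tree ar (leaf_typed ar t) (eff_tree M).
Proof. intros. now apply (wf_config_tree _ ([], M)), closed_config. Qed.

(* The disjunction over [V] in [P] of the conjunction, over the [W] not above [V], of a
   formula separating [V] from [W]. *)
Lemma Rv_upset t (P : val Sig -> Prop) : exists phi : VF ar O t, frag_v t phi /\
  forall W, vtyped ar [] W t ->
    sat_v interp phi W <-> exists V, P V /\ Rv t V W.
Proof.
  assert (sep : forall VW : {VW : val Sig * val Sig |
      vtyped ar [] (fst VW) t /\ vtyped ar [] (snd VW) t /\ ~ Rv t (fst VW) (snd VW)},
    {phi : VF ar O t | frag_v t phi /\ sat_v interp phi (fst (proj1_sig VW)) /\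
                       ~ sat_v interp phi (snd (proj1_sig VW))}).
  { intros [[V W] (HV & HW & N)]. apply constructive_indefinite_description. simpl in *.
    apply NNPP. intros E. apply N. repeat split; auto. intros phi Hphi HphiV.
    apply NNPP. intros HphiW. apply E. eauto. }
  exists (VOr (fun V : {V | P V /\ vtyped ar [] V t} =>
          VAnd (fun W : {W | vtyped ar [] W t /\ ~ Rv t (proj1_sig V) W} =>
            proj1_sig (sep (exist _ (proj1_sig V, proj1_sig W)
              (conj (proj2 (proj2_sig V)) (proj2_sig W))))))).
  split.
  - destruct (classic neg) as [n|n]; [now left|right]. simpl. intros V W.
    destruct (sep _) as (phi & [?|?] & ?); simpl; tauto.
  - intros W HW. simpl. split.
    + intros [[V [HP HV]] H]. simpl in H. exists V. split; auto.
      apply NNPP. intros N. specialize (H (exist _ W (conj HW N))). revert H.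
      destruct (sep _) as (phi & ? & ? & ?); simpl in *; tauto.
    + intros (V & HP & HR). pose proof HR as (HV & _ & HR').
      exists (exist _ V (conj HP HV)). intros [W' [HW' N]].
      destruct (sep _) as (phi & Hf & Hs & ?); simpl in *. auto.
Qed.

(** The logical preorder is a simulation: the upward closure of [P] is defined by one formula of the
    fragment, and putting the modality in front of it transports the observation from [M] to [N]. *)
Lemma Rc_lift t M N : Rc t M N -> lift interp (Rv t) (eff_tree M) (eff_tree N).
Proof.
  intros (HM & HN & H) o P Hi. destruct (Rv_upset t P) as (phi & Hphi & E).
  assert (HPhi : sat_c interp (CMod o phi) N).
  { apply H.
    - destruct Hphi; [now left|now right].
    - simpl. revert Hi. eapply interp_restrict_sub; eauto using wf_eff_tree.
      intros V HV HP. apply E; eauto using Rv_refl. }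
  revert HPhi. simpl. eapply interp_restrict_sub; eauto using wf_eff_tree.
  intros W HW. now apply E.
Qed.

(* Coinduction: simulations preserve formulas *)
Scheme VF_mut := Induction for VF Sort Prop
with CF_mut := Induction for CF Sort Prop.
Combined Scheme VF_CF_ind from VF_mut, CF_mut.

(** Converse of [Rc_lift]. In the modal case the [Sv]-image of the predicate defined by [phi] stays
    inside it by induction, and modalities are monotone; symmetry serves the two negation cases. *)
Theorem simulation_le
  (Sv : ty -> val Sig -> val Sig -> Prop) (Sc : ty -> com Sig -> com Sig -> Prop) :
  (forall V W, Sv tN V W -> V = W) ->
  (forall a b V W A, Sv (tArr a b) V W -> vtyped ar [] A a ->
     Sc b (CApp V A) (CApp W A)) ->
  (forall t M N, Sc t M N -> ctyped ar [] N t) ->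
  (forall t M N, Sc t M N -> lift interp (Sv t) (eff_tree M) (eff_tree N)) ->
  (neg -> forall t V W, Sv t V W -> Sv t W V) ->
  (neg -> forall t M N, Sc t M N -> Sc t N M) ->
  (forall t (phi : VF ar O t), frag_v t phi ->
     forall V W, Sv t V W -> sat_v interp phi V -> sat_v interp phi W) /\
  (forall t (Phi : CF ar O t), frag_c t Phi ->
     forall M N, Sc t M N -> sat_c interp Phi M -> sat_c interp Phi N).
Proof.
  intros HN HA HT HL Hsv Hsc. unfold frag_v, frag_c.
  apply VF_CF_ind; simpl.
  - intros n _ V W H%HN. congruence.
  - intros a b [A tA] Phi IH Hf V W HS. apply IH; eauto.
  - intros t I f IH Hf V W HS H i. apply (IH i) with V; auto. destruct Hf; auto.
  - intros t I f IH Hf V W HS [i Hi]. exists i. apply (IH i) with V; auto. destruct Hf; auto.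
  - intros t phi IH [n|[]] V W HS H H'. apply H. apply (IH (or_introl n) W V); auto.
  - intros t o phi IH Hf M N HS Hi. apply (HL _ _ _ HS) in Hi. revert Hi.
    eapply interp_restrict_sub; eauto using wf_eff_tree.
    intros W _ (V & HV & HVW). eapply IH; eauto.
  - intros t I f IH Hf M N HS H i. apply (IH i) with M; auto. destruct Hf; auto.
  - intros t I f IH Hf M N HS [i Hi]. exists i. apply (IH i) with M; auto. destruct Hf; auto.
  - intros t Phi IH [n|[]] M N HS H H'. apply H. apply (IH (or_introl n) N M); auto.
Qed.

(** The simulation keeps [Rv] on values and relates computations by the lifting of [Rv], in both
    directions if there is negation; thus computation formulas see no more than liftings of [Rv]. *)
Lemma lift_Rc t M N : ctyped ar [] M t -> ctyped ar [] N t ->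
  lift interp (Rv t) (eff_tree M) (eff_tree N) ->
  (neg -> lift interp (Rv t) (eff_tree N) (eff_tree M)) -> Rc t M N.
Proof.
  intros HM HN H H'. repeat split; auto. intros Phi HPhi.
  eapply (simulation_le Rv (fun t M N => ctyped ar [] M t /\ ctyped ar [] N t /\
    lift interp (Rv t) (eff_tree M) (eff_tree N) /\
    (neg -> lift interp (Rv t) (eff_tree N) (eff_tree M)))); eauto; clear -Hscott.
  - apply Rv_nat.
  - intros a b V W A HS HA. pose proof (Rv_app _ _ _ _ _ HS HA) as HR.
    pose proof HR as (? & ? & _). auto 6 using Rc_lift, Rc_sym.
  - tauto.
  - tauto.
  - intros. now apply Rv_sym.
  - tauto.
Qed.

(** Extensionality at arrow types, obtained from a simulation that is applicative at arrow types and
    [Rv] elsewhere instead of by a separate induction on formulas of arrow type. *)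
Lemma app_Rv a b V W : vtyped ar [] V (tArr a b) -> vtyped ar [] W (tArr a b) ->
  (forall A, vtyped ar [] A a -> Rc b (CApp V A) (CApp W A)) -> Rv (tArr a b) V W.
Proof.
  intros HV HW H. repeat split; auto. intros phi Hphi.
  eapply (simulation_le (fun t V W => match t with
      | tArr a b => forall A, vtyped ar [] A a -> Rc b (CApp V A) (CApp W A)
      | _ => Rv t V W
      end) Rc); eauto; clear -Hscott.
  - apply Rv_nat.
  - now intros t M N (_ & ? & _).
  - intros t M N HR. pose proof HR as (_ & HN & _).
    eapply lift_sub; eauto using Rc_lift, wf_eff_tree.
    intros V W HS. destruct t; auto. intros. eapply Rv_app; eauto.
  - intros n [] V W HS; auto using Rv_sym, Rc_sym.
  - intros n t M N. now apply Rc_sym.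
Qed.

(** * Howe's method on closed terms *)

(** Since [U] is an arbitrary open value, substitutivity is built in ([Hv_subst]); the trailing [Rv]
    makes the relation absorb [Rv] on the right ([Hv_Rv]). *)
Inductive Hv : ty -> val Sig -> val Sig -> Prop :=
| Hv_intro G t U s s' W :
    vtyped ar G U t ->
    (forall i a, nth_error G i = Some a -> Hv a (s i) (s' i)) ->
    Rv t (subst_v s' U) W -> Hv t (subst_v s U) W.

(** Only values are substituted, so the recursion goes through [Hv] alone. *)
Inductive Hc : ty -> com Sig -> com Sig -> Prop :=
| Hc_intro G t C s s' N :
    ctyped ar G C t ->
    (forall i a, nth_error G i = Some a -> Hv a (s i) (s' i)) ->
    Rc t (subst_c s' C) N -> Hc t (subst_c s C) N.

Lemma Hv_typed t V W : Hv t V W -> vtyped ar [] V t /\ vtyped ar [] W t.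
Proof.
  induction 1 as [G t U s s' W HU _ IH (_ & HW & _)]. split; auto.
  eapply typed_subst; eauto. intros i a E. now destruct (IH i a E).
Qed.

Lemma Hs_typed G s s' :
  (forall i a, nth_error G i = Some a -> Hv a (s i) (s' i)) ->
  styped ar G [] s /\ styped ar G [] s'.
Proof. intros H. split; intros i a E; destruct (Hv_typed _ _ _ (H i a E)); auto. Qed.

Lemma Hc_typed t M N : Hc t M N -> ctyped ar [] M t /\ ctyped ar [] N t.
Proof.
  destruct 1 as [G t C s s' N HC Hs (_ & HN & _)]. split; auto.
  eapply typed_subst; eauto. now apply Hs_typed in Hs.
Qed.

Lemma Rv_Hv t V W : Rv t V W -> Hv t V W.
Proof.
  intros H. pose proof H as (HV & _ & _).
  rewrite <- (proj1 subst_var V). apply Hv_intro with (G := []) (s' := VVar); auto.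
  - intros [|i] a; discriminate.
  - now rewrite (proj1 subst_var V).
Qed.

Lemma Rc_Hc t M N : Rc t M N -> Hc t M N.
Proof.
  intros H. pose proof H as (HM & _ & _).
  rewrite <- (proj2 subst_var M). apply Hc_intro with (G := []) (s' := VVar); auto.
  - intros [|i] a; discriminate.
  - now rewrite (proj2 subst_var M).
Qed.

Lemma Hv_refl t V : vtyped ar [] V t -> Hv t V V.
Proof. intros. now apply Rv_Hv, Rv_refl. Qed.

Lemma Hv_Rv t U V W : Hv t U V -> Rv t V W -> Hv t U W.
Proof.
  destruct 1 as [G t U s s' V HU Hs HR]. intros HR'.
  eapply Hv_intro; eauto using Rv_trans.
Qed.

Lemma Hc_Rc t L M N : Hc t L M -> Rc t M N -> Hc t L N.
Proof.
  destruct 1 as [G t C s s' M HC Hs HR]. intros HR'.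
  eapply Hc_intro; eauto using Rc_trans.
Qed.

Lemma Hv_subst G t U s s' : vtyped ar G U t ->
  (forall i a, nth_error G i = Some a -> Hv a (s i) (s' i)) ->
  Hv t (subst_v s U) (subst_v s' U).
Proof.
  intros HU Hs. eapply Hv_intro; eauto. apply Rv_refl.
  eapply typed_subst; eauto. now apply Hs_typed in Hs.
Qed.

Lemma Hc_subst G t C s s' : ctyped ar G C t ->
  (forall i a, nth_error G i = Some a -> Hv a (s i) (s' i)) ->
  Hc t (subst_c s C) (subst_c s' C).
Proof.
  intros HC Hs. eapply Hc_intro; eauto. apply Rc_tree; auto;
  (eapply typed_subst; eauto; now apply Hs_typed in Hs).
Qed.

Lemma Hs_scons G a V V' s s' : Hv a V V' ->
  (forall i b, nth_error G i = Some b -> Hv b (s i) (s' i)) ->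
  forall i b, nth_error (a :: G) i = Some b -> Hv b (scons V s i) (scons V' s' i).
Proof. intros HV Hs [|i] b; simpl; intros E; [congruence|auto]. Qed.

Lemma Hv_app a b V W A A' :
  Hv (tArr a b) V W -> Hv a A A' -> Hc b (CApp V A) (CApp W A').
Proof.
  intros HV HA.
  apply (Hc_subst [tArr a b; a] b (CApp (VVar 0) (VVar 1)) (scons V (scons A VVar))
           (scons W (scons A' VVar))).
  - econstructor; constructor; reflexivity.
  - apply Hs_scons; auto. apply Hs_scons; auto. intros [|i] c; discriminate.
Qed.

(** An open value of type [tN] is a stack of successors over zero or a variable, and for variables
    the induction hypothesis applies. Hence [case] takes the same branch on both sides and numeric
    labels of operations agree. *)
Lemma Hv_nat V W : Hv tN V W -> V = W.
Proof.
  intros H. remember tN as t. revert Heqt.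
  induction H as [G t U s s' W HU _ IH HR]. intros ->. apply Rv_nat in HR as <-.
  revert HU. clear -IH. intros HU. remember tN as t. induction HU; try discriminate; simpl; auto.
  - f_equal. auto.
  - apply (IH i a); auto.
Qed.

(** The abstraction either comes from [U], and then both bodies are instances of one open body under
    substitutions extended by the arguments, or [U] is a variable and the abstraction was
    substituted for it, which is the induction hypothesis. The trailing [Rv], applied to [A'], is
    absorbed on the right. *)
Lemma Hv_beta a b a' B W A A' :
  Hv (tArr a b) (VLam a' B) W -> Hv a A A' -> Hc b (subst1 B A) (CApp W A').
Proof.
  intros H HA. remember (tArr a b) as t. remember (VLam a' B) as V. revert Heqt HeqV.
  induction H as [G t U s s' W HU Hs IH HR]. intros -> EV.
  destruct (Hv_typed _ _ _ HA) as [_ HA'].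
  pose proof (Rv_app _ _ _ _ _ HR HA') as HR'.
  inversion HU; subst; simpl in EV; try discriminate.
  - injection EV as -> <-. rewrite subst1_ups.
    eapply Hc_Rc; [|exact HR'].
    apply Hc_Rc with (subst_c (scons A' s') M); [eapply Hc_subst; eauto using Hs_scons|].
    pose proof HR' as (T & _ & _). rewrite <- subst1_ups.
    assert (HM : ctyped ar [] (subst1 (subst_c (ups s') M) A') b).
    { rewrite subst1_ups. eapply typed_subst; eauto. apply styped_scons; auto.
      now apply Hs_typed in Hs. }
    apply Rc_tree; auto. symmetry. now apply config_tree_step.
  - eapply Hc_Rc; [|exact HR']. eapply IH; eauto.
Qed.

Lemma lift_Hv_Rc n t M N N' : ctyped ar [] M t -> Rc t N N' ->
  lift interp (Hv t) (approx n ([], M)) (eff_tree N) ->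
  lift interp (Hv t) (approx n ([], M)) (eff_tree N').
Proof.
  intros HM HR H. pose proof HR as (_ & HN & _).
  eapply lift_sub; [eauto|eapply wf_eff_tree, HN| |
    eapply lift_comp; eauto using wf_eff_tree, Rc_lift].
  intros V W (U & ? & ?). eapply Hv_Rv; eauto.
Qed.

Lemma Hc_approx n t M N : Hc t M N -> lift interp (Hv t) (approx n ([], M)) (eff_tree N).
Proof.
  revert t M N. induction n as [|n IH]; intros t M N H.
  { eapply lift_bot; eauto. eapply wf_eff_tree. exact (proj2 (Hc_typed _ _ _ H)). }
  pose proof (Hc_typed _ _ _ H) as [HM _].
  destruct H as [G t C s s' N HC Hs HR].
  apply lift_Hv_Rc with (subst_c s' C); auto. clear N HR.
  pose proof (Hs_typed _ _ _ Hs) as [Ts Ts'].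
  assert (HN : ctyped ar [] (subst_c s' C) t) by (eapply typed_subst; eauto).
  assert (HU : forall U a, vtyped ar G U a -> Hv a (subst_v s U) (subst_v s' U))
    by eauto using Hv_subst.
  (* When both sides reduce, only the left one pays with fuel: the right tree does not change under
     reduction. *)
  assert (next : forall M' N', stepf ([], subst_c s C) = Some ([], M') ->
    stepf ([], subst_c s' C) = Some ([], N') -> Hc t M' N' ->
    lift interp (Hv t) (approx (S n) ([], subst_c s C)) (eff_tree (subst_c s' C))).
  { intros M' N' E E' H.
    change (lift interp (Hv t) (approx (S n) ([], subst_c s C))
      (config_tree ([], subst_c s' C))).
    rewrite (config_tree_step _ _ E'). cbn [approx]. rewrite E. now apply IH. }
  pose proof (closed_config _ _ _ HM) as CM. pose proof (closed_config _ _ _ HN) as CN.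
  destruct HC as [G a b U1 U2 H1 H2|G a U H1|G a b C1 C2 H1 H2|G a b U H1|G a U C1 C2 H1 H2 H3
    |G a e k Cs He Hk Hall|G a e k U Cs He H1 Hk Hall|G a e U He H1|G a e U U2 He H1 H2];
  cbn [subst_c] in *.
  (* Only the left application is reduced; [Hv_beta] relates its reduct to the unreduced right-hand
     one. *)
  - pose proof (HU _ _ H1) as HF. destruct (Hv_typed _ _ _ HF) as [T _].
    destruct (closed_arrow _ _ _ _ T) as (B & E & _). rewrite E in *.
    cbn [approx stepf]. apply IH. eapply Hv_beta; eauto.
  - destruct (Hv_typed _ _ _ (HU _ _ H1)). eapply lift_ret; eauto.
  - change (lift interp (Hv b) (approx (S n) ([], CLet (subst_c s C1) (subst_c (ups s) C2)))
      (config_tree ([], CLet (subst_c s' C1) (subst_c (ups s') C2)))).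
    rewrite (config_tree_step ([], CLet (subst_c s' C1) _) _ eq_refl). cbn [approx stepf].
    inversion HM; inversion HN; subst.
    assert (ctyped ar (a :: []) (subst_c (ups s) C2) b)
      by (eapply typed_subst; eauto using styped_ups).
    assert (ctyped ar (a :: []) (subst_c (ups s') C2) b)
      by (eapply typed_subst; eauto using styped_ups).
    assert (ctyped ar [] (subst_c s C1) a) by (eapply typed_subst; eauto).
    assert (ctyped ar [] (subst_c s' C1) a) by (eapply typed_subst; eauto).
    eapply lift_let with (a := a) (S := Hv a); eauto.
    + apply IH. eapply Hc_subst; eauto.
    + intros V V' HV _ _. rewrite !subst1_ups. apply IH.
      eapply Hc_subst; eauto using Hs_scons.
  - pose proof (HU _ _ H1) as HF. destruct (Hv_typed _ _ _ HF) as [T T'].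
    destruct (closed_arrow _ _ _ _ T) as (B & E & _).
    destruct (closed_arrow _ _ _ _ T') as (B' & E' & _).
    apply next with (M' := CRet (fix_unfold a (subst_v s U)))
      (N' := CRet (fix_unfold a (subst_v s' U))); [now rewrite E|now rewrite E'|].
    (* Unfolding commutes with substitution, so the two unfoldings are again instances of one open
       term. *)
    rewrite <- !subst_fix_unfold.
    apply (Hc_subst G _ (CRet (fix_unfold a U))); auto.
    constructor. eapply fix_unfold_typed; eauto.
  - pose proof (HU _ _ H1) as HF. destruct (Hv_typed _ _ _ HF) as [T _].
    apply Hv_nat in HF. rewrite <- HF in *.
    destruct (closed_nat _ _ T) as [[|k] E]; rewrite E in *; simpl in *;
    (eapply next; [reflexivity|reflexivity|]).
    + eapply Hc_subst; eauto.
    + rewrite !subst1_ups. eapply Hc_subst; eauto. apply Hs_scons; auto.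
      apply Hv_refl, numeral_typed.
  - eapply lift_op; eauto; simpl; auto. intros i d d'. rewrite !nth_error_map.
    destruct (nth_error Cs i) as [C|] eqn:Ei; [|discriminate].
    apply nth_error_In in Ei. intros [= <-] [= <-]. apply IH. eapply Hc_subst; eauto.
  - pose proof (HU _ _ H1) as HF. destruct (Hv_typed _ _ _ HF) as [T _].
    apply Hv_nat in HF. rewrite <- HF in *.
    destruct (closed_nat _ _ T) as [m E]; rewrite E in *.
    eapply lift_op; eauto; simpl; rewrite ?num_of_numeral; simpl; auto; try discriminate.
    intros i d d'. rewrite !nth_error_map.
    destruct (nth_error Cs i) as [C|] eqn:Ei; [|discriminate].
    apply nth_error_In in Ei. intros [= <-] [= <-]. apply IH. eapply Hc_subst; eauto.
  - eapply lift_op; eauto; simpl; auto. intros i d d' [= <-] [= <-]. apply IH.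
    eapply Hv_app; eauto using Hv_refl, numeral_typed.
  - pose proof (HU _ _ H1) as HF. destruct (Hv_typed _ _ _ HF) as [T _].
    apply Hv_nat in HF. rewrite <- HF in *.
    destruct (closed_nat _ _ T) as [m E]; rewrite E in *.
    eapply lift_op; eauto; simpl; rewrite ?num_of_numeral; simpl; auto; try discriminate.
    intros i d d' [= <-] [= <-]. apply IH.
    eapply Hv_app; eauto using Hv_refl, numeral_typed.
Qed.

Lemma Hc_lift t M N : Hc t M N -> lift interp (Hv t) (eff_tree M) (eff_tree N).
Proof.
  intros H. destruct (Hc_typed _ _ _ H) as [HM HN].
  eapply (lift_limit ar interp Hscott _ ([], M)); eauto using closed_config, Hc_approx.
Qed.

(* In the presence of negation the coinduction principle asks for a symmetric relation;
   the transitive closure of Howe's relation is symmetric. *)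
Notation Sv t := (clos_trans _ (Hv t)).
Notation Sc t := (clos_trans _ (Hc t)).

Lemma Sv_typed t V W : Sv t V W -> vtyped ar [] V t /\ vtyped ar [] W t.
Proof. induction 1; [now apply Hv_typed|tauto]. Qed.

Lemma Sc_typed t M N : Sc t M N -> ctyped ar [] M t /\ ctyped ar [] N t.
Proof. induction 1; [now apply Hc_typed|tauto]. Qed.

Definition update (s : nat -> val Sig) j V : nat -> val Sig :=
  fun i => if i =? j then V else s i.

Lemma Hv_update G s j a V V' : styped ar G [] s -> nth_error G j = Some a -> Hv a V V' ->
  forall i b, nth_error G i = Some b -> Hv b (update s j V i) (update s j V' i).
Proof.
  intros Ts Ej HV i b E. unfold update. destruct (Nat.eqb_spec i j) as [->|]; [congruence|].
  now apply Hv_refl, Ts.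
Qed.

(** The chains for different variables may have different lengths and cannot be run in parallel;
    they are run one variable at a time, [mix j] having already switched the variables below [j],
    with reflexivity at the others. *)
Lemma update_chain (A : Type) (R : A -> A -> Prop) (f : (nat -> val Sig) -> A) G s s' :
  (forall s s', (forall i a, nth_error G i = Some a -> Hv a (s i) (s' i)) -> R (f s) (f s')) ->
  (forall i a, nth_error G i = Some a -> Sv a (s i) (s' i)) ->
  clos_trans _ R (f s) (f s').
Proof.
  intros Hf HS.
  assert (Ts : styped ar G [] s) by (intros i a E; now apply (Sv_typed _ _ _ (HS i a E))).
  assert (Ts' : styped ar G [] s') by (intros i a E; now apply (Sv_typed _ _ _ (HS i a E))).
  set (mix := fun j i => if i <? j then s' i else s i).
  assert (Tm : forall j, styped ar G [] (mix j)).
  { intros j i a E. unfold mix. destruct (i <? j); auto. }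
  assert (H : forall j, j <= length G -> clos_trans _ R (f s) (f (mix j))).
  { induction j as [|j IH]; intros L.
    (* [clos_trans] is not reflexive, so the empty chain is replaced by one reflexive step. *)
    - apply t_step, Hf. intros i a E. now apply Hv_refl, Ts.
    - apply t_trans with (f (mix j)); [apply IH; lia|].
      destruct (nth_error G j) as [a|] eqn:Ej; [|apply nth_error_None in Ej; lia].
      replace (mix j) with (update (mix j) j (s j)).
      2: { extensionality i. unfold update, mix. destruct (Nat.eqb_spec i j) as [->|]; auto.
           now rewrite Nat.ltb_irrefl. }
      replace (mix (S j)) with (update (mix j) j (s' j)).
      2: { extensionality i. unfold update, mix. destruct (Nat.eqb_spec i j) as [->|].
           - now rewrite (proj2 (Nat.ltb_lt j (S j))) by lia.
           - destruct (Nat.ltb_spec i j), (Nat.ltb_spec i (S j)); auto; lia. }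
      generalize (HS j a Ej). generalize (s j) (s' j). induction 1.
      + apply t_step, Hf. eapply Hv_update; eauto.
      + eapply t_trans; eauto. }
  (* [mix (length G)] and [s'] may differ outside [G], hence a last step that is reflexive on [G]
     instead of an equality. *)
  apply t_trans with (f (mix (length G))); auto.
  apply t_step, Hf. intros i a E. unfold mix.
  rewrite (proj2 (Nat.ltb_lt i (length G))); [now apply Hv_refl, Ts'|].
  apply nth_error_Some. congruence.
Qed.

(** Reversing one step: the trailing [Rv] is symmetric and comes first, then the reversed chains for
    the substituted values are combined inside [U]. *)
Lemma Sv_sym t V W : neg -> Sv t V W -> Sv t W V.
Proof.
  intros n. induction 1 as [V W H|]; [|eapply t_trans; eauto].
  induction H as [G t U s s' W HU _ IH HR].
  apply t_trans with (subst_v s' U); [now apply t_step, Rv_Hv, Rv_sym|].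
  apply (update_chain _ _ (fun s => subst_v s U) G); eauto using Hv_subst.
Qed.

Lemma Sc_sym t M N : neg -> Sc t M N -> Sc t N M.
Proof.
  intros n. induction 1 as [M N H|]; [|eapply t_trans; eauto].
  destruct H as [G t C s s' N HC Hs HR].
  apply t_trans with (subst_c s' C); [now apply t_step, Rc_Hc, Rc_sym|].
  apply (update_chain _ _ (fun s => subst_c s C) G); eauto using Hc_subst.
  intros i a E. apply Sv_sym; auto. apply t_step. eauto.
Qed.

Lemma Howe_le : (forall t V W, Hv t V W -> Rv t V W) /\ (forall t M N, Hc t M N -> Rc t M N).
Proof.
  destruct (simulation_le (fun t => Sv t) (fun t => Sc t)) as [IV IC].
  - induction 1; [now apply Hv_nat|congruence].
  - intros a b V W A H HA. induction H as [V W H|]; [|eapply t_trans; eauto].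
    apply t_step. eapply Hv_app; eauto using Hv_refl.
  - intros t M N H. now apply Sc_typed in H.
  - intros t M N H. pose proof (Sc_typed _ _ _ H) as [_ HN]. revert HN.
    induction H as [M N H|L M N H IH H' IH']; intros HN.
    + eapply lift_sub with (S := Hv t); eauto using wf_eff_tree, Hc_lift, t_step.
    + apply Sc_typed in H' as HM. destruct HM as [HM _].
      eapply lift_sub; [eauto|eapply wf_eff_tree, HN| |eapply lift_comp; eauto using wf_eff_tree].
      intros V W (U & ? & ?). eapply t_trans; eauto.
  - intros n t V W. now apply Sv_sym.
  - intros n t M N. now apply Sc_sym.
  - split.
    + intros t V W H. destruct (Hv_typed _ _ _ H). repeat split; auto.
      intros phi Hphi. apply IV; auto. now apply t_step.
    + intros t M N H. destruct (Hc_typed _ _ _ H). repeat split; auto.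
      intros Phi HPhi. apply IC; auto. now apply t_step.
Qed.

(** * Compatibility *)

Lemma Rc_subst G t C s s' : ctyped ar G C t ->
  (forall i a, nth_error G i = Some a -> Rv a (s i) (s' i)) ->
  Rc t (subst_c s C) (subst_c s' C).
Proof. intros HC Hs. apply Howe_le, Hc_subst with G; auto using Rv_Hv. Qed.

Lemma Rc_subst1 a t C V W : ctyped ar [a] C t -> Rv a V W ->
  Rc t (subst_c (scons V VVar) C) (subst_c (scons W VVar) C).
Proof.
  intros HC HV. eapply Rc_subst; eauto. intros [|i] b; simpl; intros E; [congruence|].
  now destruct i.
Qed.

Lemma Rc_steps t M N M' N' : ctyped ar [] M t -> ctyped ar [] N t ->
  stepf ([], M) = Some ([], M') -> stepf ([], N) = Some ([], N') -> Rc t M' N' -> Rc t M N.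
Proof.
  intros HM HN E E' H. apply Rc_trans with M'; [now apply Rc_step|].
  apply Rc_trans with N'; auto. pose proof H as (_ & HN' & _).
  apply Rc_tree; auto. symmetry. exact (config_tree_step _ _ E').
Qed.

(** The sequencing argument already used for Howe's relation is run again, now with [Rv] on the
    leaves. *)
Lemma lift_let_Rc a b M M' N N' :
  Rc a M M' -> ctyped ar [a] N b -> ctyped ar [a] N' b ->
  (forall V V', Rv a V V' -> Rc b (subst1 N V) (subst1 N' V')) ->
  lift interp (Rv b) (eff_tree (CLet M N)) (eff_tree (CLet M' N')).
Proof.
  intros HM HN HN' H. pose proof HM as (T & T' & _).
  change (lift interp (Rv b) (config_tree ([], CLet M N)) (config_tree ([], CLet M' N'))).
  rewrite (config_tree_step ([], CLet M N) _ eq_refl),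
    (config_tree_step ([], CLet M' N') _ eq_refl).
  eapply (lift_limit ar interp Hscott _ ([N], M)); [eauto using let_config|]. intros n.
  eapply lift_let with (S := Rv a); eauto.
  - apply lift_approx with (ar := ar) (a := a); auto using closed_config. now apply Rc_lift.
  - intros V V' HV _ _. pose proof (H V V' HV) as HR. pose proof HR as (T1 & _ & _).
    apply lift_approx with (ar := ar) (a := b); auto using closed_config. now apply Rc_lift.
Qed.

Lemma Rc_let a b M M' N N' :
  Rc a M M' -> ctyped ar [a] N b -> ctyped ar [a] N' b ->
  (forall V V', Rv a V V' -> Rc b (subst1 N V) (subst1 N' V')) ->
  Rc b (CLet M N) (CLet M' N').
Proof.
  intros HM HN HN' H. pose proof HM as (T & T' & _).
  apply lift_Rc; try (econstructor; eauto).
  - eapply lift_let_Rc; eauto.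
  - intros n. eapply lift_let_Rc; eauto using Rc_sym. intros V V' HV.
    apply Rc_sym; auto. apply H. now apply Rv_sym.
Qed.

Lemma lift_op_Rc t M N :
  ctyped ar [] M t -> ctyped ar [] N t -> terminal ([], M) -> terminal ([], N) ->
  is_op (label_of ([], M)) -> label_of ([], N) = label_of ([], M) ->
  (forall i d d', child_of ([], M) i = Some d -> child_of ([], N) i = Some d' ->
     fst d = [] /\ fst d' = [] /\ Rc t (snd d) (snd d')) ->
  lift interp (Rv t) (eff_tree M) (eff_tree N).
Proof.
  intros HM HN TM TN Hop HL H.
  eapply (lift_limit ar interp Hscott _ ([], M)); [eauto using closed_config|]. intros [|n].
  - eapply lift_bot; eauto using wf_eff_tree.
  - eapply (lift_op ar interp Hscott Hdec (Rv t) n ([], M) ([], N)); eauto using closed_config.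
    intros i [K1 M1] [K2 N1] E E'. destruct (H _ _ _ E E') as (E1 & E2 & HR). simpl in *. subst.
    pose proof HR as (T & _ & _). apply lift_approx with (ar := ar) (a := t);
    auto using closed_config. now apply Rc_lift.
Qed.

Lemma Rc_op t M N :
  ctyped ar [] M t -> ctyped ar [] N t -> terminal ([], M) -> terminal ([], N) ->
  is_op (label_of ([], M)) -> label_of ([], N) = label_of ([], M) ->
  (forall i d d', child_of ([], M) i = Some d -> child_of ([], N) i = Some d' ->
     fst d = [] /\ fst d' = [] /\ Rc t (snd d) (snd d')) ->
  Rc t M N.
Proof.
  intros HM HN TM TN Hop HL H. apply lift_Rc; auto.
  - now apply lift_op_Rc.
  - intros n. apply lift_op_Rc; auto; [now rewrite HL|].
    intros i d d' E E'. destruct (H i d' d E' E) as (? & ? & ?). auto using Rc_sym.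
Qed.

Lemma Rc_children s Ms Ns G t i d d' :
  styped ar G [] s -> Forall2 (open_c ar Rc G t) Ms Ns ->
  match nth_error (map (fun M => subst_c s M) Ms) i with
  | Some M => Some ([] : list (com Sig), M) | None => None
  end = Some d ->
  match nth_error (map (fun M => subst_c s M) Ns) i with
  | Some M => Some ([] : list (com Sig), M) | None => None
  end = Some d' ->
  fst d = [] /\ fst d' = [] /\ Rc t (snd d) (snd d').
Proof.
  intros Hs HF. revert i. induction HF as [|M N Ms Ns (_ & _ & HR) _ IH]; intros [|i]; simpl;
  try discriminate; eauto.
  intros [= <-] [= <-]; simpl. auto.
Qed.

Lemma Forall2_open_typed G t Ms Ns : Forall2 (open_c ar Rc G t) Ms Ns ->
  (forall M, In M Ms -> ctyped ar G M t) /\ (forall N, In N Ns -> ctyped ar G N t).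
Proof.
  induction 1 as [|M N Ms Ns (HM & HN & _) _ [IH IH']]; simpl; [tauto|].
  split; intros ? [<-|]; auto.
Qed.

Theorem compatible_le : compatible ar (open_v ar Rv) (open_c ar Rc).
Proof.
  repeat apply conj.
  - intros G i a E. repeat apply conj; try (now constructor).
    intros s Hs. now apply Rv_refl, Hs.
  - intros G. repeat apply conj; try (now constructor). intros. apply Rv_refl. constructor.
  - intros G. repeat apply conj; try (now constructor). intros. apply Rv_refl. constructor.
  - intros G V W (HV & HW & H). repeat apply conj; try (now constructor).
    intros s Hs. pose proof (H s Hs) as HR. simpl. rewrite <- (Rv_nat _ _ HR).
    apply Rv_refl. constructor. apply HR.
  - intros G a b M N (HM & HN & H). repeat apply conj; try (now constructor).
    intros s Hs. simpl.
    assert (T : vtyped ar [] (VLam a (subst_c (ups s) M)) (tArr a b)).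
    { constructor. eapply typed_subst; eauto. now apply styped_ups. }
    assert (T' : vtyped ar [] (VLam a (subst_c (ups s) N)) (tArr a b)).
    { constructor. eapply typed_subst; eauto. now apply styped_ups. }
    apply app_Rv; auto. intros A HA.
    eapply Rc_steps; [econstructor; eauto|econstructor; eauto|reflexivity|reflexivity|].
    rewrite !subst1_ups. now apply H, styped_scons.
  - intros G a V W (HV & HW & H). repeat apply conj; try (now constructor).
    (* [return] is the context [return x] with related values substituted for its variable; [fix]
       below is treated in the same way. *)
    intros s Hs. apply (Rc_subst1 a a (CRet (VVar 0))); auto. now repeat constructor.
  - intros G a b V V' W W' (HV & HV' & H) (HW & HW' & H').
    repeat apply conj; [econstructor; eauto|econstructor; eauto|].
    intros s Hs. apply Howe_le. eapply Hv_app; apply Rv_Hv; auto.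
  - intros G a b V W (HV & HW & H). repeat apply conj; try (now constructor).
    intros s Hs. apply (Rc_subst1 (tArr (tArr a b) (tArr a b)) _ (CFix (VVar 0))); auto.
    now repeat constructor.
  - intros G a V V' M M' N N' (HV & HV' & H) (HM & HM' & H1) (HN & HN' & H2).
    assert (T : ctyped ar G (CCase V M N) a) by (constructor; auto).
    assert (T' : ctyped ar G (CCase V' M' N') a) by (constructor; auto).
    repeat apply conj; auto. intros s Hs.
    pose proof (proj2 (typed_subst ar) _ _ _ T _ _ Hs) as Ts.
    pose proof (proj2 (typed_subst ar) _ _ _ T' _ _ Hs) as Ts'.
    pose proof (H s Hs) as HR. simpl in *. rewrite <- (Rv_nat _ _ HR) in *.
    destruct HR as (TV & _ & _). destruct (closed_nat _ _ TV) as [[|n] E]; rewrite E in *;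
    simpl in *; (eapply Rc_steps; [eauto|eauto|reflexivity|reflexivity|]); auto.
    rewrite !subst1_ups. apply H2, styped_scons; auto using numeral_typed.
  - intros G a b M M' N N' (HM & HM' & H) (HN & HN' & H').
    repeat apply conj; [econstructor; eauto|econstructor; eauto|].
    intros s Hs. simpl. apply Rc_let with a; auto;
      try (eapply typed_subst; eauto; now apply styped_ups).
    intros V V' HV. rewrite !subst1_ups. pose proof HV as (TV & TV' & _).
    (* The value is changed inside [N] by substitutivity of [R], and only then [N] is replaced by
       [N'] under a common substitution, as the open extension permits. *)
    apply Rc_trans with (subst_c (scons V' s) N); [|now apply H', styped_scons].
    eapply Rc_subst; eauto. intros [|i] c; simpl; intros E; [congruence|].
    now apply Rv_refl, Hs.
  - intros G a s n Ms Ns E L HF. destruct (Forall2_open_typed _ _ _ _ HF) as [TM TN].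
    assert (T : ctyped ar G (COp s Ms) a) by (econstructor; eauto).
    assert (T' : ctyped ar G (COp s Ns) a).
    { econstructor; eauto. now rewrite <- (Forall2_length HF). }
    repeat apply conj; auto. intros sg Hs.
    pose proof (proj2 (typed_subst ar) _ _ _ T _ _ Hs) as Ts.
    pose proof (proj2 (typed_subst ar) _ _ _ T' _ _ Hs) as Ts'.
    apply Rc_op; simpl; auto. intros i d d'. eapply Rc_children; eauto.
  - intros G a s n V V' Ms Ns E (HV & HV' & H) L HF.
    destruct (Forall2_open_typed _ _ _ _ HF) as [TM TN].
    assert (T : ctyped ar G (COpN s V Ms) a) by (econstructor; eauto).
    assert (T' : ctyped ar G (COpN s V' Ns) a).
    { econstructor; eauto. now rewrite <- (Forall2_length HF). }
    repeat apply conj; auto. intros sg Hs.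
    pose proof (proj2 (typed_subst ar) _ _ _ T _ _ Hs) as Ts.
    pose proof (proj2 (typed_subst ar) _ _ _ T' _ _ Hs) as Ts'.
    pose proof (H sg Hs) as HR. simpl in *. rewrite <- (Rv_nat _ _ HR) in *.
    destruct HR as (TV & _ & _). destruct (closed_nat _ _ TV) as [m Em]; rewrite Em in *.
    apply Rc_op; simpl; rewrite ?num_of_numeral; simpl; auto; try discriminate.
    intros i d d'. eapply Rc_children; eauto.
  - intros G a s V V' E (HV & HV' & H).
    assert (T : ctyped ar G (COpI s V) a) by (econstructor; eauto).
    assert (T' : ctyped ar G (COpI s V') a) by (econstructor; eauto).
    repeat apply conj; auto. intros sg Hs.
    pose proof (proj2 (typed_subst ar) _ _ _ T _ _ Hs) as Ts.
    pose proof (proj2 (typed_subst ar) _ _ _ T' _ _ Hs) as Ts'.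
    apply Rc_op; simpl; auto. intros i d d' [= <-] [= <-]. split; [|split]; auto.
    eapply Rv_app; eauto using numeral_typed.
  - intros G a s W W' V V' E (HW & HW' & H1) (HV & HV' & H).
    assert (T : ctyped ar G (COpNI s W V) a) by (econstructor; eauto).
    assert (T' : ctyped ar G (COpNI s W' V') a) by (econstructor; eauto).
    repeat apply conj; auto. intros sg Hs.
    pose proof (proj2 (typed_subst ar) _ _ _ T _ _ Hs) as Ts.
    pose proof (proj2 (typed_subst ar) _ _ _ T' _ _ Hs) as Ts'.
    pose proof (H1 sg Hs) as HR. simpl in *. rewrite <- (Rv_nat _ _ HR) in *.
    destruct HR as (TW & _ & _). destruct (closed_nat _ _ TW) as [m Em]; rewrite Em in *.
    apply Rc_op; simpl; rewrite ?num_of_numeral; simpl; auto; try discriminate.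
    intros i d d' [= <-] [= <-]. split; [|split]; auto.
    eapply Rv_app; eauto using numeral_typed.
Qed.
End Behaviour.

(** * Specialisation to the two logics and passage to equivalences *)

Lemma frag_v_all (Sig : Type) (ar : Sig -> arity) (O : Type) : @frag_v Sig ar O True = allV.
Proof.
  extensionality t. extensionality phi. apply propositional_extensionality.
  unfold frag_v, allV. tauto.
Qed.

Lemma frag_c_all (Sig : Type) (ar : Sig -> arity) (O : Type) : @frag_c Sig ar O True = allC.
Proof.
  extensionality t. extensionality Phi. apply propositional_extensionality.
  unfold frag_c, allC. tauto.
Qed.

Lemma frag_v_pos (Sig : Type) (ar : Sig -> arity) (O : Type) : @frag_v Sig ar O False = posV.
Proof.
  extensionality t. extensionality phi. apply propositional_extensionality.
  unfold frag_v, posV. tauto.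
Qed.

Lemma frag_c_pos (Sig : Type) (ar : Sig -> arity) (O : Type) : @frag_c Sig ar O False = posC.
Proof.
  extensionality t. extensionality Phi. apply propositional_extensionality.
  unfold frag_c, posC. tauto.
Qed.

(** Open extension commutes with intersecting a relation with its converse, so each clause is used
    once in each direction. *)
Lemma compatible_sym (Sig : Type) (ar : Sig -> arity)
  (R R' : ty -> val Sig -> val Sig -> Prop) (S S' : ty -> com Sig -> com Sig -> Prop) :
  (forall t V W, R' t V W <-> R t V W /\ R t W V) ->
  (forall t M N, S' t M N <-> S t M N /\ S t N M) ->
  compatible ar (open_v ar R) (open_c ar S) -> compatible ar (open_v ar R') (open_c ar S').
Proof.
  intros HR HS.
  assert (EV : forall G t V W,
    open_v ar R' G t V W <-> open_v ar R G t V W /\ open_v ar R G t W V).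
  { intros. unfold open_v. setoid_rewrite HR. firstorder. }
  assert (EC : forall G t M N,
    open_c ar S' G t M N <-> open_c ar S G t M N /\ open_c ar S G t N M).
  { intros. unfold open_c. setoid_rewrite HS. firstorder. }
  (* The equality of lengths is for the reversed direction, where the arity condition has to hold of
     the right-hand list. *)
  assert (EF : forall G t Ms Ns, Forall2 (open_c ar S' G t) Ms Ns ->
    length Ns = length Ms /\
    Forall2 (open_c ar S G t) Ms Ns /\ Forall2 (open_c ar S G t) Ns Ms).
  { intros G t. induction 1 as [|M N Ms Ns [H H']%EC _ (? & ? & ?)]; simpl; auto. }
  intros (C1 & C2 & C3 & C4 & C5 & C6 & C7 & C8 & C9 & C10 & C11 & C12 & C13 & C14).
  repeat apply conj; intros;
  repeat match goal with
  | H : open_v ar R' _ _ _ _ |- _ => apply EV in H as [? ?]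
  | H : open_c ar S' _ _ _ _ |- _ => apply EC in H as [? ?]
  | H : Forall2 (open_c ar S' _ _) _ _ |- _ => apply EF in H as (? & ? & ?)
  end; (apply EV || apply EC); split; eauto; eauto using eq_trans.
Qed.

Theorem theorem1 (Sig : Type) (ar : Sig -> arity) (O : Type)
  (interp : O -> tree Sig unit -> Prop)
  (Hsub : forall o t, interp o t -> T1 ar t)
  (Hscott : forall o, scott_open ar (interp o))
  (Hdec : decomposable ar interp) :
  (* open extension of the behavioural equivalence for V is compatible *)
  compatible ar (open_v ar (eq_L_v ar interp allV)) (open_c ar (eq_L_c ar interp allC)) /\
  (* open extension of the positive behavioural preorder for V+ is compatible *)
  compatible ar (open_v ar (le_L_v ar interp posV)) (open_c ar (le_L_c ar interp posC)) /\
  (* consequently, open extension of the equivalence for V+ is compatible *)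
  compatible ar (open_v ar (eq_L_v ar interp posV)) (open_c ar (eq_L_c ar interp posC)).
Proof.
  pose proof (compatible_le ar interp Hscott Hdec True) as Hall.
  pose proof (compatible_le ar interp Hscott Hdec False) as Hpos.
  rewrite frag_v_all, frag_c_all in Hall. rewrite frag_v_pos, frag_c_pos in Hpos.
  split; [|split; auto].
  - eapply compatible_sym; [..|exact Hall]; reflexivity.
  - eapply compatible_sym; [..|exact Hpos]; reflexivity.
Qed.
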